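(* Let $K$ be a compact set of finite dimension and let $f:K\to K$ be a minimal homeomorphism. Then for generic continuous $A:K\to \mathrm{SL}(2,\mathbb{R})$ (i.e. for all $A$ in a residual subset of $C(K,\mathrm{SL}(2,\mathbb{R}))$), either $(f,A)$ is uniformly hyperbolic or $(f,A)$ has uniform subexponential growth.
   Context: A compact set $K$ has finite dimension if it is homeomorphic to a subset of some $\mathbb{R}^n$. A homeomorphism $f:K\to K$ is minimal if every orbit $\{f^n(x): n\in\mathbb{Z}\}$ is dense in $K$. For continuous $A:K\to\mathrm{SL}(2,\mathbb{R})$, the cocycle $(f,A)$ acts on $K\times\mathbb{R}^2$ by $(x,y)\mapsto(f(x),A(x)\cdot y)$; its iterates are $(f,A)^n=(f^n,A_n)$, so for $n\ge 1$, $A_n(x)=A(f^{n-1}(x))\cdots A(f(x))A(x)$. $\|\cdot\|$ is the operator norm induced by the Euclidean norm on $\mathbb{R}^2$. The cocycle $(f,A)$ is uniformly hyperbolic if there exist $\epsilon>0$ and $N>0$ such that $\|A_n(x)\|\ge e^{\epsilon n}$ for every $x\in K$ and $n\ge N$. The cocycle $(f,A)$ has uniform subexponential growth if for every $\epsilon>0$ there exists $N>0$ such that $\|A_n(x)\|\le e^{\epsilon n}$ for every $x\in K$ and $n\ge N$. The space $C(K,\mathrm{SL}(2,\mathbb{R}))$ of continuous maps carries the topology of uniform convergence; ''generic'' means belonging to a residual set, i.e. a set containing a countable intersection of open dense sets. *)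

(* Defs.v *)
From HB Require Import structures.
From mathcomp Require Import all_boot all_order all_algebra.
From mathcomp Require Import all_classical all_reals all_analysis.
From mathcomp Require Import borel_hierarchy.

Set Implicit Arguments.
Unset Strict Implicit.
Unset Printing Implicit Defensive.

Import Order.TTheory GRing.Theory Num.Theory.
Import numFieldNormedType.Exports.
Local Open Scope classical_set_scope.
Local Open Scope ring_scope.

Record homeo (X Y : topologicalType) := Homeo {
  homeo_fun :> X -> Y;
  homeo_inv : Y -> X;
  homeo_funK : cancel homeo_fun homeo_inv;
  homeo_invK : cancel homeo_inv homeo_fun;
  homeo_continuous : continuous homeo_fun;
  homeo_inv_continuous : continuous homeo_inv }.

(* [S] is used as the type [set_type S], whose library topology is the one
   induced by the inclusion into ['rV[R]_n]. *)
Definition finite_dimension (R : realType) (K : topologicalType) : Prop :=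
  exists (n : nat) (S : set 'rV[R]_n), inhabited (homeo K S).

(* [Negz k] denotes the integer [- k.+1]. *)
Definition ziter (X : topologicalType) (f : homeo X X) (n : int) : X -> X :=
  match n with
  | Posz k => iter k f
  | Negz k => iter k.+1 (homeo_inv f)
  end.

Definition minimal (X : topologicalType) (f : homeo X X) : Prop :=
  forall x : X, dense [set ziter f n x | n in [set: int]].

Definition residual (T : topologicalType) (G : set T) : Prop :=
  exists2 S : set T, Gdelta_dense S & S `<=` G.

Definition SL2 (R : realType) := set_type [set M : 'M[R]_2 | \det M = 1].

HB.instance Definition _ (R : realType) := PseudoMetric.on (SL2 R).

(* The continuous maps from [K] to [SL2 R] with the topology of uniform
   convergence. The uniform structure on [SL2 R] is the one induced by the
   entrywise sup norm on matrices. *)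
Definition CSL2 (R : realType) (K : topologicalType) :=
  initial_topology
    (fun A : continuousType K (SL2 R) => (A : {uniform K -> SL2 R})).

HB.instance Definition _ (R : realType) (K : topologicalType) :=
  Uniform.on (CSL2 R K).

(* The norm ['|v|] that the library puts on matrices is the sup norm. *)
Definition euclidean_norm (R : realType) (n : nat) (v : 'cV[R]_n) : R :=
  Num.sqrt (\sum_(i < n) v i ord0 ^+ 2).

Definition opnorm (R : realType) (n : nat) (M : 'M[R]_n) : R :=
  sup [set euclidean_norm (M *m v) |
        v in [set v : 'cV[R]_n | euclidean_norm v <= 1]].

Definition cocycle (R : realType) (K : Type) (f : K -> K) (A : K -> SL2 R)
    (p : K * 'cV[R]_2) : K * 'cV[R]_2 :=
  (f p.1, val (A p.1) *m p.2).

Fixpoint cocycle_iter (R : realType) (K : Type) (f : K -> K) (A : K -> SL2 R)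
    (n : nat) (x : K) : 'M[R]_2 :=
  if n is m.+1 then val (A (iter m f x)) *m cocycle_iter f A m x else 1%:M.

Lemma iter_cocycle (R : realType) (K : Type) (f : K -> K) (A : K -> SL2 R)
    (n : nat) (x : K) (y : 'cV[R]_2) :
  iter n (cocycle f A) (x, y) = (iter n f x, cocycle_iter f A n x *m y).
Proof.
elim: n => [|n IHn] /=; first by rewrite mul1mx.
by rewrite IHn /cocycle /= mulmxA.
Qed.

Definition uniformly_hyperbolic (R : realType) (K : Type) (f : K -> K)
    (A : K -> SL2 R) : Prop :=
  exists2 eps : R, 0 < eps &
  exists2 N : nat, (0 < N)%N &
  forall (x : K) (n : nat), (N <= n)%N ->
    expR (eps * n%:R) <= opnorm (cocycle_iter f A n x).

Definition uniform_subexponential_growth (R : realType) (K : Type) (f : K -> K)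
    (A : K -> SL2 R) : Prop :=
  forall eps : R, 0 < eps ->
  exists2 N : nat, (0 < N)%N &
  forall (x : K) (n : nat), (N <= n)%N ->
    opnorm (cocycle_iter f A n x) <= expR (eps * n%:R).

(* Main.v *)
Require Import Defs.
From HB Require Import structures.
From mathcomp Require Import all_boot all_order all_algebra.
From mathcomp Require Import all_classical all_reals all_analysis.
From mathcomp Require Import ring lra zify.

(** The residual set is the intersection over k of the sets U_k, where U_k is
the union of the interior of the set of uniformly hyperbolic cocycles and of the
set of cocycles A having an iterate with ||A_m(x)|| < (1 + 1/(k+1))^m for all x.
The latter set is open because K is compact, so only the density of U_k is at
stake ([dense_rates]): if a nonempty open set of cocycles is not contained in the
uniformly hyperbolic ones, it contains a cocycle A which is not uniformly
hyperbolic, and it is enough to perturb that A into small uniform growth.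

Perturbations are A(x) -> R(x) A(x) with R(x) a rotation by a small angle
depending continuously on x.

- Local step.  Follow the directions reachable from a given one by small
  rotations inserted along an orbit segment.  They form a cone which every step
  widens on both sides by a fixed angle.  Either the cone fills the projective
  line, so that every direction is reached, or the matrices of the segment,
  read in moving frames carried by the sides of the cones, are positive with
  permanent/determinant ratio at least [cone_rate] > 1; the permanent being
  supermultiplicative on positive matrices, the unperturbed product then grows
  exponentially at a definite rate ([unreachable_growth]).  Since A is not
  uniformly hyperbolic, some segment grows too slowly for that; on it, and on
  nearby segments, any direction can be sent to any other one.  By minimality
  every orbit meets such segments with bounded gaps.

- Cancellation.  On an orbit segment of length n, choose a time k such that the
  products P before k and Q after k have comparable norms, and near k use an
  accessible segment to send the image of the direction expanded by P to the
  direction contracted by Q.  The perturbed product of the whole segment is then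
  bounded independently of n ([cancel_growth], [bounded_program]).

- Global step, when f has no periodic point.  A small open set cuts every orbit
  into blocks of bounded but large length; on each block one of finitely many
  cancelling programs is played, selected by the position of the initial point.
  The resulting rotation is a function of the signs of chi_s - 1/2 along a
  window of the orbit, for finitely many continuous functions chi_s, and it is
  made continuous by multiplying it by a factor that vanishes when one of these
  differences vanishes.  Blocks met by this factor are lost, so they have to be
  rare.  This is where finite dimension enters: K being in R^d, there are
  arbitrarily many families of separated small cubes such that each point is
  badly placed with respect to at most d of them ([kolmogorov_families]).
  Using a different family for each pair (function, time), the chi_s are
  perturbed so that every orbit of a prescribed length M meets the levels
  chi_s = 1/2 at most d times ([general_position]).  As M can be chosen after
  the length of the blocks, the lost blocks contribute a bounded factor
  ([growth], [nunsafe_le]).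

- If f has a periodic point then K is a single periodic orbit, all points are
  related by a bounded time, and a cocycle which is not uniformly hyperbolic
  already has small uniform growth ([periodic_rate_below]).

Growth is measured with the sum of the absolute values of the entries, which is
submultiplicative, invariant under inversion in SL(2,R), and within a factor 4
of the operator norm. *)

Set Implicit Arguments.
Unset Strict Implicit.
Unset Printing Implicit Defensive.

Import Order.TTheory GRing.Theory Num.Theory.
Import numFieldNormedType.Exports.
Local Open Scope classical_set_scope.
Local Open Scope ring_scope.

(** * Uniform convergence of continuous maps to SL(2,R) *)

Section topo.
Variables (R : realType) (K : topologicalType).

Lemma ball_mxE (m n : nat) (M N : 'M[R]_(m, n)) (d : R) :
  0 < d -> ball M d N = (forall i j, `|M i j - N i j| < d).
Proof.
move=> d0; rewrite propeqE; split => [[_ h] i j|h]; first by have := h i j.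
by split=> // i j; exact: h.
Qed.

Lemma nbhs_CSL2P (A : CSL2 R K) (U : set (CSL2 R K)) :
  nbhs A U <-> exists2 d : R, 0 < d & forall B : CSL2 R K,
    (forall x i j, `|val (A x) i j - val (B x) i j| < d) -> U B.
Proof.
split.
- move=> [_ [[W oW <-] WA WU]].
  have : nbhs (A : {uniform K -> SL2 R}) W by apply: open_nbhs_nbhs.
  move=> /uniform_nbhs [E [entE EW]].
  move: entE => [V].
  rewrite -entourage_ballE => -[d /= d0 dV] VE.
  exists d => // B hB; apply/WU/EW => x _; apply/VE/dV => /=.
  by rewrite (ball_mxE _ _ d0) => i j; exact: hB.
- move=> [d d0 h].
  set V := [set M : SL2 R * SL2 R | forall i j, `|val M.1 i j - val M.2 i j| < d].
  have entV : entourage V.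
    exists [set M | ball M.1 d M.2]; last by move=> M; rewrite /= (ball_mxE _ _ d0).
    by rewrite -entourage_ballE; exists d.
  have : nbhs (A : {uniform K -> SL2 R})
     [set g : {uniform K -> SL2 R} | forall y, setT y -> V (A y, g y)].
    by apply/uniform_nbhs; exists V; split.
  move=> nW.
  have cv := @initial_continuous (continuousType K (SL2 R)) {uniform K -> SL2 R} (fun A : continuousType K (SL2 R) => (A : {uniform K -> SL2 R})).
  apply: (@filterS _ (nbhs (A : CSL2 R K)) _ _ _ _ (cv A _ nW)) => B /= hB; apply: h => x i j; exact: (hB x I i j).
Qed.

Lemma val_CSL2_continuous (A : CSL2 R K) : continuous (fun x => val (A x)).
Proof.
move=> x; apply: (@continuous_comp K (SL2 R) 'M[R]_2 A val); first exact: cts_fun.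
exact: initial_continuous.
Qed.

Lemma mk_CSL2 (g : K -> 'M[R]_2) : continuous g -> (forall x, \det (g x) = 1) ->
  exists A : CSL2 R K, forall x, val (A x) = g x.
Proof.
move=> cg dg.
pose h x : SL2 R := exist _ (g x) (mem_set (dg x)).
have ch : continuous h by apply: continuous_comp_initial.
pose HA := isContinuous.Build K (SL2 R) h ch.
pose A : continuousType K (SL2 R) := HB.pack h HA.
by exists A.
Qed.

End topo.

(** * Matrices and vectors of the plane *)

Section planar.
Variable R : realType.
Implicit Types (u v w p q y : 'cV[R]_2) (M N E : 'M[R]_2).

(** For a matrix of size 2 this is within a factor 4 of the operator norm; no
supremum is involved, so continuity and submultiplicativity are immediate. *)
Definition l1norm m n (M : 'M[R]_(m, n)) : R := \sum_i \sum_j `|M i j|.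

Definition mx2 (a b c d : R) : 'M[R]_2 := \matrix_(i, j)
  if i == 0 then (if j == 0 then a else b) else (if j == 0 then c else d).

Lemma mx2E a b c d : (mx2 a b c d 0 0 = a) * (mx2 a b c d 0 1 = b) *
  (mx2 a b c d 1 0 = c) * (mx2 a b c d 1 1 = d).
Proof. by rewrite !mxE. Qed.

Lemma ord2P (i : 'I_2) : i = 0 \/ i = 1.
Proof. by case: i => [[|[|//]]] h; [left|right]; apply: val_inj. Qed.

Lemma eq_mx2 M N : M 0 0 = N 0 0 -> M 0 1 = N 0 1 -> M 1 0 = N 1 0 ->
  M 1 1 = N 1 1 -> M = N.
Proof.
by move=> h00 h01 h10 h11; apply/matrixP => i j;
  case: (ord2P i) => ->; case: (ord2P j) => ->.
Qed.

Lemma eq_cV2 u v : u 0 0 = v 0 0 -> u 1 0 = v 1 0 -> u = v.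
Proof.
by move=> h0 h1; apply/matrixP => i j; rewrite ord1; case: (ord2P i) => ->.
Qed.

Lemma mulmx2E m n (A : 'M[R]_(m, 2)) (B : 'M[R]_(2, n)) i j :
  (A *m B) i j = A i 0 * B 0 j + A i 1 * B 1 j.
Proof.
rewrite mxE !big_ord_recl big_ord0 addr0; congr (_ * _ + _ * _).
  by congr (A i _); apply: val_inj.
by congr (B _ j); apply: val_inj.
Qed.

Lemma lin2E m n (a b : R) (A B : 'M[R]_(m, n)) i j :
  (a *: A + b *: B) i j = a * A i j + b * B i j.
Proof. by rewrite !mxE. Qed.

Lemma scale2E m n (a : R) (A : 'M[R]_(m, n)) i j : (a *: A) i j = a * A i j.
Proof. by rewrite mxE. Qed.

Lemma det_mx2 M : \det M = M 0 0 * M 1 1 - M 0 1 * M 1 0.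
Proof.
rewrite (expand_det_row M 0) !big_ord_recl big_ord0 addr0 /cofactor.
rewrite !det_mx11 !mxE /= expr0 expr1 mul1r mulN1r mulrN.
by congr (_ * M _ _ - M _ _ * M _ _); apply: val_inj.
Qed.

Lemma l1normE2 M : l1norm M = `|M 0 0| + `|M 0 1| + (`|M 1 0| + `|M 1 1|).
Proof.
rewrite /l1norm !big_ord_recl !big_ord0 !addr0.
by congr (_ + `|M _ _| + (`|M _ _| + `|M _ _|)); apply: val_inj.
Qed.

Lemma l1norm_ge0 m n (M : 'M[R]_(m, n)) : 0 <= l1norm M.
Proof. by apply: sumr_ge0 => i _; apply: sumr_ge0. Qed.

Lemma l1normM m n k (M : 'M[R]_(m, n)) (N : 'M[R]_(n, k)) :
  l1norm (M *m N) <= l1norm M * l1norm N.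
Proof.
rewrite /l1norm mulr_suml; apply: ler_sum => i _.
rewrite mulr_suml; apply: (@le_trans _ _ (\sum_j \sum_l `|M i l| * `|N l j|)).
  apply: ler_sum => j _; rewrite mxE; apply: le_trans (ler_norm_sum _ _ _) _.
  by apply: ler_sum => l _; rewrite normrM.
rewrite exchange_big /=; apply: ler_sum => l _.
rewrite -mulr_sumr ler_wpM2l //.
rewrite [leRHS](bigD1 l) //= lerDl.
by apply: sumr_ge0 => j _; apply: sumr_ge0.
Qed.

Lemma l1normD m n (M N : 'M[R]_(m, n)) : l1norm (M + N) <= l1norm M + l1norm N.
Proof.
rewrite /l1norm -big_split /=; apply: ler_sum => i _.
rewrite -big_split /=; apply: ler_sum => j _; rewrite mxE; exact: ler_normD.
Qed.

Lemma l1norm_det1 M : \det M = 1 -> 1 <= l1norm M.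
Proof.
rewrite det_mx2 l1normE2 => d1.
have h : 1 <= `|M 0 0| * `|M 1 1| + `|M 0 1| * `|M 1 0|.
  by rewrite -!normrM -[leLHS]normr1 -d1; exact: ler_normB.
have := normr_ge0 (M 0 0); have := normr_ge0 (M 0 1).
have := normr_ge0 (M 1 0); have := normr_ge0 (M 1 1).
move: `|M 0 0| `|M 0 1| `|M 1 0| `|M 1 1| h => a b c d h a0 b0 c0 d0.
by nra.
Qed.

(** The adjugate, that is the inverse of a matrix of determinant one. *)
Definition adj2 M := mx2 (M 1 1) (- M 0 1) (- M 1 0) (M 0 0).

Lemma mul_adj2 M : \det M = 1 -> adj2 M *m M = 1%:M.
Proof.
rewrite det_mx2 => d1; apply: eq_mx2; rewrite mulmx2E !mx2E !mxE /=; lra.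
Qed.

Lemma l1norm_adj2 M : l1norm (adj2 M) = l1norm M.
Proof. by rewrite !l1normE2 !mx2E !normrN; ring. Qed.

Definition cross u v : R := u 0 0 * v 1 0 - u 1 0 * v 0 0.
Definition sqn u : R := u 0 0 ^+ 2 + u 1 0 ^+ 2.

Lemma sqn_ge0 u : 0 <= sqn u.
Proof. by rewrite /sqn addr_ge0 // sqr_ge0. Qed.

Lemma sqn_gt0 u : u != 0 -> 0 < sqn u.
Proof.
move=> u0; rewrite lt_neqAle sqn_ge0 andbT; apply: contra u0 => /eqP/esym.
move=> /eqP; rewrite /sqn paddr_eq0 ?sqr_ge0 // !sqrf_eq0 => /andP[/eqP h0 /eqP h1].
by apply/eqP/eq_cV2; rewrite ?h0 ?h1 mxE.
Qed.

Lemma cross_det M u v : \det M = 1 -> cross (M *m u) (M *m v) = cross u v.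
Proof.
rewrite det_mx2 => d1; rewrite /cross !mulmx2E -[RHS]mul1r -d1; ring.
Qed.

Lemma cross_sqn u v : cross u v ^+ 2 <= sqn u * sqn v.
Proof.
rewrite /cross /sqn; have := sqr_ge0 (u 0 0 * v 0 0 + u 1 0 * v 1 0).
by set a := u 0 0; set b := u 1 0; set c := v 0 0; set d := v 1 0; nra.
Qed.

Definition rotmx (c s : R) : 'M[R]_2 := mx2 c (- s) s c.

Lemma det_rotmx c s : c ^+ 2 + s ^+ 2 = 1 -> \det (rotmx c s) = 1.
Proof. by move=> <-; rewrite det_mx2 !mx2E; ring. Qed.

Lemma sqn_rotmx c s u : c ^+ 2 + s ^+ 2 = 1 -> sqn (rotmx c s *m u) = sqn u.
Proof.
move=> h; rewrite /sqn !mulmx2E !mx2E -[RHS]mul1r -h; ring.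
Qed.

(** Rotations by an angle at most the one whose cosine is [c0]; angles
themselves are avoided. *)
Definition rotset (c0 : R) (E : 'M[R]_2) :=
  exists c s, [/\ E = rotmx c s, c ^+ 2 + s ^+ 2 = 1 & c0 <= c].

(** A nonnegative combination of two small rotations is a multiple of a rotation
by an intermediate angle: complex numbers in a convex sector are closed
under such combinations. *)
Lemma rotset_combine (c0 c1 s1 c2 s2 a b : R) w :
  0 < c0 -> c1 ^+ 2 + s1 ^+ 2 = 1 -> c2 ^+ 2 + s2 ^+ 2 = 1 ->
  c0 <= c1 -> c0 <= c2 -> 0 <= a -> 0 <= b -> 
  exists2 E, rotset c0 E & exists2 rho, 0 <= rho &
    a *: (rotmx c1 s1 *m w) + b *: (rotmx c2 s2 *m w) = E *m (rho *: w).
Proof.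
move=> c0_gt0 h1 h2 c01 c02 a0 b0.
have [ab0|abN0] := eqVneq (a + b) 0.
  have [-> ->] : a = 0 /\ b = 0 by split; lra.
  exists (rotmx c1 s1); first by exists c1, s1.
  by exists 0; rewrite // !scale0r mulmx0 addr0.
have ab_gt0 : 0 < a + b by rewrite lt_neqAle eq_sym abN0 addr_ge0.
set C := a * c1 + b * c2; set S := a * s1 + b * s2.
have C_ge : c0 * (a + b) <= C.
  by rewrite /C mulrDr lerD // mulrC ler_wpM2l.
have C_gt0 : 0 < C by apply: lt_le_trans C_ge; rewrite mulr_gt0.
set rho := Num.sqrt (C ^+ 2 + S ^+ 2).
have rho2 : rho ^+ 2 = C ^+ 2 + S ^+ 2.
  by rewrite sqr_sqrtr // addr_ge0 // sqr_ge0.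
have rho_gt0 : 0 < rho.
  by rewrite sqrtr_gt0 ltr_wpDr ?sqr_ge0 // exprn_gt0.
have rho_neq0 : rho != 0 by rewrite gt_eqF.
have rho_le : rho <= a + b.
  rewrite -ler_sqr ?nnegrE ?(ltW rho_gt0) ?(ltW ab_gt0) // rho2 /C /S.
  have hc : c1 * c2 + s1 * s2 <= 1.
    by have := sqr_ge0 (c1 - c2); have := sqr_ge0 (s1 - s2); nra.
  have -> : (a * c1 + b * c2) ^+ 2 + (a * s1 + b * s2) ^+ 2 =
    a ^+ 2 * (c1 ^+ 2 + s1 ^+ 2) + b ^+ 2 * (c2 ^+ 2 + s2 ^+ 2)
     + 2 * (a * b) * (c1 * c2 + s1 * s2) by ring.
  rewrite h1 h2; have -> : (a + b) ^+ 2 = a ^+ 2 * 1 + b ^+ 2 * 1 + 2 * (a * b) by ring.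
  by rewrite lerD2l ler_piMr // !mulr_ge0.
exists (rotmx (C / rho) (S / rho)).
  exists (C / rho), (S / rho); split => //.
    by rewrite !expr_div_n -mulrDl -rho2 divff // expf_neq0.
  rewrite ler_pdivlMr //; apply: le_trans C_ge; by rewrite ler_wpM2l // ltW.
exists rho; first exact: ltW.
by apply: eq_cV2; rewrite !(lin2E, scale2E, mulmx2E, mx2E) /C /S; field.
Qed.

(** Later factors act on the left, as in the iterates of a cocycle. *)
Fixpoint mprod (B : nat -> 'M[R]_2) (n : nat) : 'M[R]_2 :=
  if n is m.+1 then B m *m mprod B m else 1%:M.

End planar.

(** * Widening a cone of directions *)

Section cone.
Variable R : realType.
Implicit Types (u v w p q y : 'cV[R]_2) (M N E : 'M[R]_2) (c s : R).

Lemma cramer2 u v y : cross u v != 0 ->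
  y = (cross y v / cross u v) *: u + (cross u y / cross u v) *: v.
Proof.
move=> h; apply: eq_cV2; rewrite lin2E; move: h; rewrite /cross => h; field;
  exact: h.
Qed.

Lemma rotmx10 u : rotmx 1 0 *m u = u.
Proof. by apply: eq_cV2; rewrite !(mulmx2E, mx2E); ring. Qed.

Section rotation.
Variables (c s : R).
Hypotheses (c_gt0 : 0 < c) (s_gt0 : 0 < s) (cs1 : c ^+ 2 + s ^+ 2 = 1).

Lemma unit_cos_le1 : c <= 1.
Proof. by move: cs1 (sqr_ge0 s) => h1 h2; nra. Qed.

Lemma unit_circleN : c ^+ 2 + (- s) ^+ 2 = 1.
Proof. by rewrite sqrrN. Qed.

Lemma unit_circle10 : (1 : R) ^+ 2 + 0 ^+ 2 = 1.
Proof. by rewrite expr1n expr0n /= addr0. Qed.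

(** If [q] lies less than half a turn after [p] and this persists when the pair
is spread by the angle on both sides, then it also holds when only [q] is
moved: in terms of angles this is an average, and it follows from R + R^-1 =
2 cos. *)
Lemma cross_half p q : 0 < cross p q ->
  0 < cross (rotmx c (- s) *m p) (rotmx c s *m q) ->
  0 < cross p (rotmx c s *m q).
Proof.
move=> h1 h2; have e : 2 * c * cross p (rotmx c s *m q) =
    cross p q + cross (rotmx c (- s) *m p) (rotmx c s *m q).
  rewrite -[cross p q]mul1r -[X in X * cross p q]cs1.
  by rewrite /cross !(mulmx2E, mx2E); ring.
have : 0 < 2 * c * cross p (rotmx c s *m q) by rewrite e addr_gt0.
by rewrite pmulr_rgt0 // mulr_gt0.
Qed.

Lemma cross_rot u : cross u (rotmx c s *m u) = s * sqn u.
Proof. by rewrite /cross /sqn !(mulmx2E, mx2E); ring. Qed.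

Lemma cross_rotN u : cross (rotmx c (- s) *m u) u = s * sqn u.
Proof. by rewrite /cross /sqn !(mulmx2E, mx2E); ring. Qed.

(** The directions obtained by rotating, by an angle of cosine at least [c], a
direction of the cone spanned by [p] and [q]; the scalar [r] may be negative
because only directions matter. *)
Definition widened_cone p q y := exists2 E, rotset c E & exists a b r,
  [/\ 0 <= a, 0 <= b, r != 0 & r *: y = E *m (a *: p + b *: q)].

Lemma widened_coneN p q y : widened_cone p q (- y) -> widened_cone p q y.
Proof.
move=> [E hE [a [b [r [a0 b0 r0 e]]]]]; exists E => //; exists a, b, (- r).
by rewrite oppr_eq0; split => //; rewrite -e scalerN scaleNr.
Qed.

Lemma widened_cone_mid p q a b : 0 <= a -> 0 <= b -> widened_cone p q (a *: p + b *: q).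
Proof.
move=> a0 b0; exists (rotmx 1 0); first by exists 1, 0; rewrite unit_circle10 unit_cos_le1.
by exists a, b, 1; rewrite oner_eq0 scale1r rotmx10.
Qed.

Lemma widened_cone_left p q a b : 0 <= a -> 0 <= b ->
  widened_cone p q (a *: (rotmx c (- s) *m p) + b *: p).
Proof.
move=> a0 b0.
have [E hE [rho rho0]] := rotset_combine p c_gt0 unit_circleN unit_circle10 (lexx c) unit_cos_le1 a0 b0.
rewrite rotmx10 => ->; exists E => //; exists rho, 0, 1.
by rewrite oner_eq0 scale1r scale0r addr0.
Qed.

Lemma widened_cone_right p q a b : 0 <= a -> 0 <= b ->
  widened_cone p q (a *: q + b *: (rotmx c s *m q)).
Proof.
move=> a0 b0.
have [E hE [rho rho0]] := rotset_combine q c_gt0 unit_circle10 cs1 unit_cos_le1 (lexx c) a0 b0.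
rewrite rotmx10 => ->; exists E => //; exists 0, rho, 1.
by rewrite oner_eq0 scale1r scale0r add0r.
Qed.

Lemma cross0 u : (cross 0 u = 0) * (cross u 0 = 0).
Proof. by rewrite /cross !mxE; split; ring. Qed.

Lemma cross_neq0 u v : cross u v != 0 -> u != 0 /\ v != 0.
Proof. by move=> h; split; apply: contraNneq h => ->; rewrite cross0. Qed.

Lemma crossC u v : cross u v = - cross v u.
Proof. by rewrite /cross; ring. Qed.

Lemma cross_lin2r u v w a b :
  cross u (a *: v + b *: w) = a * cross u v + b * cross u w.
Proof. by rewrite /cross !lin2E; ring. Qed.

Lemma cross_lin2l u v w a b :
  cross (a *: v + b *: w) u = a * cross v u + b * cross w u.
Proof. by rewrite /cross !lin2E; ring. Qed.

(** The cone between [P] and [Q] is the union of the three cones cut out by [p]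
and [q]; a direction of a lateral cone is a rotated side of the original
cone. *)
Lemma widened_cone_arc p q y (P := rotmx c (- s) *m p) (Q := rotmx c s *m q) :
  0 < cross p q -> 0 < cross P Q ->
  (exists a b, [/\ 0 <= a, 0 <= b & y = a *: P + b *: Q]) -> widened_cone p q y.
Proof.
move=> pq PQ [a [b [a0 b0 ye]]].
have [pn0 qn0] : p != 0 /\ q != 0 by apply: cross_neq0; rewrite gt_eqF.
have pQ : 0 < cross p Q by exact: cross_half.
have Pp : 0 < cross P p by rewrite cross_rotN mulr_gt0 // sqn_gt0.
have qQ : 0 < cross q Q by rewrite cross_rot mulr_gt0 // sqn_gt0.
have Pq : 0 < cross P q.
  suff -> : cross P q = cross p Q by [].
  by rewrite /cross /P /Q !(mulmx2E, mx2E); ring.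
have Py : 0 <= cross P y.
  rewrite ye cross_lin2r; have -> : cross P P = 0 by rewrite /cross; ring.
  by rewrite mulr0 add0r mulr_ge0 // ltW.
have yQ : 0 <= cross y Q.
  rewrite ye cross_lin2l; have -> : cross Q Q = 0 by rewrite /cross; ring.
  by rewrite mulr0 addr0 mulr_ge0 // ltW.
have [yp|py] := lerP (cross p y) 0.
  rewrite (@cramer2 P p y) ?gt_eqF //; apply: widened_cone_left.
    by rewrite divr_ge0 ?(ltW Pp) // crossC oppr_ge0.
  by rewrite divr_ge0 ?(ltW Pp).
have [qy|yq] := lerP (cross y q) 0.
  rewrite (@cramer2 q Q y) ?gt_eqF //; apply: widened_cone_right.
    by rewrite divr_ge0 ?(ltW qQ).
  by rewrite divr_ge0 ?(ltW qQ) // crossC oppr_ge0.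
rewrite (@cramer2 p q y) ?gt_eqF //; apply: widened_cone_mid.
  by rewrite divr_ge0 // ltW.
by rewrite divr_ge0 // ltW.
Qed.

(** When [P] and [Q] are half a turn or more apart, the widened cone together
with its opposite is the whole plane. *)
Lemma widened_cone_full p q y (P := rotmx c (- s) *m p) (Q := rotmx c s *m q) :
  0 < cross p q -> cross P Q <= 0 -> widened_cone p q y.
Proof.
move=> pq PQ.
have [pn0 qn0] : p != 0 /\ q != 0 by apply: cross_neq0; rewrite gt_eqF.
have Pp : 0 < cross P p by rewrite cross_rotN mulr_gt0 // sqn_gt0.
have qQ : 0 < cross q Q by rewrite cross_rot mulr_gt0 // sqn_gt0.
wlog py : y / 0 <= cross p y.
  move=> H; have [/H//|py] := lerP 0 (cross p y); apply/widened_coneN/H.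
  have -> : cross p (- y) = - cross p y by rewrite /cross !mxE; ring.
  by rewrite oppr_ge0 ltW.
have [yq|qy] := lerP 0 (cross y q).
  by rewrite (@cramer2 p q y) ?gt_eqF //; apply: widened_cone_mid; rewrite divr_ge0 // ltW.
have [yQ|Qy] := lerP 0 (cross y Q).
  rewrite (@cramer2 q Q y) ?gt_eqF //; apply: widened_cone_right.
    by rewrite divr_ge0 // ltW.
  by rewrite divr_ge0 ?(ltW qQ) // crossC oppr_ge0 ltW.
apply: widened_coneN; rewrite (@cramer2 P p (- y)) ?gt_eqF //.
have eN u : (cross (- y) u = - cross y u) * (cross u (- y) = - cross u y).
  by rewrite /cross !mxE; split; ring.
rewrite !eN; apply: widened_cone_left; rewrite divr_ge0 ?(ltW Pp) //.
  by rewrite -crossC.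
rewrite oppr_ge0.
have e : cross p Q * cross P y = cross p y * cross P Q + cross y Q * cross P p.
  by rewrite /cross; ring.
have pQ : 0 < cross p Q.
  have e2 : cross p q * cross y Q = cross y q * cross p Q + cross q Q * cross p y.
    by rewrite /cross; ring.
  have : cross p q * cross y Q < 0 by rewrite pmulr_rlt0.
  rewrite e2; nra.
nra.
Qed.

End rotation.
End cone.

(** * Expansion forced by iterated widening *)

Section growth.
Variable R : realType.
Implicit Types (u v w p q y : 'cV[R]_2) (M N E : 'M[R]_2) (c s : R).

Lemma eq_mprod (B B' : nat -> 'M[R]_2) n :
  (forall i, (i < n)%N -> B i = B' i) -> mprod B n = mprod B' n.
Proof.
elim: n => //= n IH h; rewrite h // IH // => i ilt; apply: h; exact: ltnW.
Qed.

Lemma mprodD (B : nat -> 'M[R]_2) m n :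
  mprod B (m + n) = mprod (fun i => B (i + m)%N) n *m mprod B m.
Proof.
elim: n => [|n IH] /=; first by rewrite addn0 mul1mx.
by rewrite addnS /= IH mulmxA addnC.
Qed.

Lemma det_mprod (B : nat -> 'M[R]_2) n :
  (forall i, \det (B i) = 1) -> \det (mprod B n) = 1.
Proof.
by move=> h; elim: n => [|n IH] /=; rewrite ?det1 // det_mulmx h IH mulr1.
Qed.

Section step.
Variables (c s : R).
Hypotheses (c_gt0 : 0 < c) (s_gt0 : 0 < s) (cs1 : c ^+ 2 + s ^+ 2 = 1).

(** The original sides in the frame of the widened ones. The matrix of this
change of frame is positive with equal diagonal entries, and its
off-diagonal product is a fixed proportion of its diagonal product; this is
what makes its permanent exceed its determinant. *)
Lemma frame_change p q (P := rotmx c (- s) *m p) (Q := rotmx c s *m q) :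
  0 < cross p q -> 0 < cross P Q ->
  exists a d d', [/\ 0 <= a, 0 <= d, 0 <= d', p = a *: P + d *: Q &
    [/\ q = d' *: P + a *: Q, s ^+ 2 * a ^+ 2 <= d * d' &
    cross p q = (a ^+ 2 - d * d') * cross P Q]].
Proof.
move=> pq PQ.
have pQ : 0 < cross p Q by apply: cross_half pq PQ.
have PQ0 : cross P Q != 0 by rewrite gt_eqF.
have Pq : cross P q = cross p Q by rewrite /cross /P /Q !(mulmx2E, mx2E); ring.
have Pp : cross P p = s * sqn P.
  by rewrite cross_rotN sqn_rotmx // sqrrN.
have qQ : cross q Q = s * sqn Q by rewrite cross_rot sqn_rotmx.
exists (cross p Q / cross P Q), (s * sqn P / cross P Q), (s * sqn Q / cross P Q).
have h2 : p = cross p Q / cross P Q *: P + s * sqn P / cross P Q *: Q.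
  by rewrite -Pp; exact: cramer2.
have h3 : q = s * sqn Q / cross P Q *: P + cross p Q / cross P Q *: Q.
  by rewrite -qQ -Pq; exact: cramer2.
have hp : sqn p = sqn P by rewrite /P sqn_rotmx // sqrrN.
have hq : sqn q = sqn Q by rewrite /Q sqn_rotmx.
split => //; [exact: divr_ge0 (ltW _) (ltW _)| | |split => //].
- by rewrite divr_ge0 ?mulr_ge0 ?sqn_ge0 // ltW.
- by rewrite divr_ge0 ?mulr_ge0 ?sqn_ge0 // ltW.
- have -> : s * sqn P / cross P Q * (s * sqn Q / cross P Q) =
    s ^+ 2 * (sqn P * sqn Q / cross P Q ^+ 2) by field.
  rewrite ler_wpM2l ?sqr_ge0 // expr_div_n ler_wpM2r ?invr_ge0 ?sqr_ge0 //.
  by rewrite -hp; exact: cross_sqn.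
- rewrite [X in cross X _]h2 [X in cross _ X]h3 cross_lin2l !cross_lin2r.
  have -> : cross Q P = - cross P Q by rewrite crossC.
  have crr u : cross u u = 0 by rewrite /cross; ring.
  by rewrite !crr; ring.
Qed.

(** [y] is, up to a nonzero scalar, the image of [u] under the first [k]
matrices, each followed by a small rotation. *)
Definition reach (B : nat -> 'M[R]_2) u k y :=
  exists2 E : nat -> 'M[R]_2, (forall i, rotset c (E i)) &
  exists2 r : R, r != 0 & mprod (fun i => E i *m B i) k *m u = r *: y.

Lemma reachS (B : nat -> 'M[R]_2) u k p q y :
  (forall a b, 0 <= a -> 0 <= b -> a *: p + b *: q != 0 ->
     reach B u k (a *: p + b *: q)) ->
  y != 0 -> widened_cone c (B k *m p) (B k *m q) y -> reach B u k.+1 y.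
Proof.
move=> hpq y0 [E hE [a [b [r [a0 b0 r0 e]]]]].
set z := a *: p + b *: q.
have e' : r *: y = E *m (B k *m z).
  by rewrite e /z (mulmxDr (B k)) -!scalemxAr.
have z0 : z != 0.
  apply: contraNneq y0 => z0; move: e'; rewrite z0 !mulmx0 => /eqP.
  by rewrite scaler_eq0 (negbTE r0).
have [F hF [r' r'0 eF]] := hpq a b a0 b0 z0.
exists (fun i => if (i < k)%N then F i else E) => [i|]; first by case: ifP.
exists (r' * r); first by rewrite mulf_neq0.
have eFB : mprod (fun i => (if (i < k)%N then F i else E) *m B i) k =
    mprod (fun i => F i *m B i) k by apply: eq_mprod => i ->.
rewrite /= ltnn eFB.
by rewrite -!mulmxA eF -!scalemxAr -e' scalerA.
Qed.

(** Invertibility propagates full reachability: reach the preimage of the target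
one step earlier and then do not rotate. *)
Lemma reachS_all (B : nat -> 'M[R]_2) u k : \det (B k) = 1 ->
  (forall y, y != 0 -> reach B u k y) ->
  (forall y, y != 0 -> reach B u k.+1 y).
Proof.
move=> dB h y y0.
have c1 : c <= 1 by exact: unit_cos_le1 cs1.
have z0 : adj2 (B k) *m y != 0.
  have dB' : B k \in unitmx by rewrite unitmxE dB unitr1.
  have : adj2 (B k) \in unitmx.
    by have /mulmx1_unit[] := mul_adj2 dB.
  move=> ua; apply: contraNneq y0 => e.
  by rewrite -[y](mulKmx ua) e mulmx0.
have [F hF [r r0 e]] := h _ z0.
exists (fun i => if (i < k)%N then F i else 1%:M) => [i|].
  case: ifP => // _; exists 1, 0; split => //; last exact: unit_circle10.
  by apply: eq_mx2; rewrite !mx2E !mxE //= oppr0.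
exists r => //.
rewrite /= ltnn mul1mx (@eq_mprod _ (fun i => F i *m B i)); last first.
  by move=> i ->.
rewrite -mulmxA e -scalemxAr mulmxA.
have -> : B k *m adj2 (B k) = 1%:M by apply: mulmx1C; exact: mul_adj2.
by rewrite mul1mx.
Qed.

(** A lower bound for the ratio permanent/determinant of the changes of frame in
[frame_change]. *)
Definition cone_rate := (1 + s ^+ 2) / (1 - s ^+ 2).

(** As long as not everything is reachable, the reachable directions contain a
cone bounded by [p] and [q], and the product has nonnegative entries in the
frames of the sides of the initial and final cones. The quantity x w + y z
is its permanent, which is supermultiplicative; multiplied by the area
spanned by the sides it grows by the factor [cone_rate] at each step. *)
Lemma cone_dichotomy (B : nat -> 'M[R]_2) u n
  (p0 := rotmx c (- s) *m (B 0%N *m u)) (q0 := rotmx c s *m (B 0%N *m u))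
  (T := mprod (fun i => B i.+1) n) :
  u != 0 -> (forall i, \det (B i) = 1) ->
  (forall y, y != 0 -> reach B u n.+1 y) \/
  exists p q, [/\ 0 < cross p q, 
    (forall a b, 0 <= a -> 0 <= b -> a *: p + b *: q != 0 ->
     reach B u n.+1 (a *: p + b *: q)) &
    exists x y z w : R, [/\ 0 <= x /\ 0 <= y, 0 <= z /\ 0 <= w, 
     T *m p0 = x *: p + y *: q,
     T *m q0 = z *: p + w *: q &
     cone_rate ^+ n * cross p0 q0 <= (x * w + y * z) * cross p q]].
Proof.
move=> u0 dB; rewrite {}/T; elim: n => [|n IH].
  right; exists p0, q0.
  have v0 : B 0%N *m u != 0.
    have ub : B 0%N \in unitmx by rewrite unitmxE dB unitr1.
    by apply: contraNneq u0 => e; rewrite -[u](mulKmx ub) e mulmx0.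
  have cr : cross p0 q0 = 2 * s * c * sqn (B 0%N *m u).
    by rewrite /cross /sqn /p0 /q0 !(mulmx2E, mx2E); ring.
  split.
  - by rewrite cr !mulr_gt0 // sqn_gt0.
  - move=> a b a0 b0 y0.
    have [E hE [rho rho0 e]] :=
      rotset_combine (B 0%N *m u) c_gt0 (unit_circleN cs1) cs1 (lexx c) (lexx c) a0 b0.
    have rhoN0 : rho != 0.
      by apply: contraNneq y0 => r0; rewrite e r0 scale0r mulmx0.
    exists (fun=> E) => //; exists rho^-1; first by rewrite invr_eq0.
    rewrite /p0 /q0 e -scalemxAr scalerA mulVf // scale1r /= mulmx1.
    by rewrite -mulmxA.
  - exists 1, 0, 0, 1; rewrite /= !mul1mx !scale1r !scale0r addr0 add0r.
    by rewrite expr0 !mul1r mul0r addr0 mul1r.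
case: IH => [all|[p [q [pq cone [x [y [z [w [[x0 y0] [z0 w0] eT0 eT1 hl]]]]]]]]].
  by left; apply: reachS_all.
set p' := B n.+1 *m p; set q' := B n.+1 *m q.
have pq' : 0 < cross p' q' by rewrite /p' /q' cross_det.
have [PQ|PQ] := lerP (cross (rotmx c (- s) *m p') (rotmx c s *m q')) 0.
  left => t t0; apply: (reachS cone) => //.
  by apply: (@widened_cone_full _ c s) => //; rewrite /p' /q'.
right; exists (rotmx c (- s) *m p'), (rotmx c s *m q'); split => //.
  move=> a b a0 b0 t0; apply: (reachS cone) => //.
  by apply: (@widened_cone_arc _ c s) => //; exists a, b.
have [a [d [d' [a0 d0 d'0 ep [eq sa ecr]]]]] := frame_change pq' PQ.
set P := rotmx c (- s) *m p' in PQ ep eq ecr *.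
set Q := rotmx c s *m q' in PQ ep eq ecr *.
exists (x * a + y * d'), (x * d + y * a), (z * a + w * d'), (z * d + w * a).
split.
- by split; rewrite addr_ge0 ?mulr_ge0.
- by split; rewrite addr_ge0 ?mulr_ge0.
- rewrite /= -mulmxA eT0 mulmxDr -!scalemxAr -/p' -/q' ep eq.
  by apply: eq_cV2; rewrite !lin2E; ring.
- rewrite /= -mulmxA eT1 mulmxDr -!scalemxAr -/p' -/q' ep eq.
  by apply: eq_cV2; rewrite !lin2E; ring.
have s1 : s ^+ 2 < 1 by rewrite -cs1 ltrDr exprn_gt0.
have s1' : 0 < 1 - s ^+ 2 by rewrite subr_gt0.
have lam0 : 0 <= cone_rate by apply: divr_ge0; [rewrite addr_ge0 ?ler01 ?sqr_ge0 | exact: ltW].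
have lamle : cone_rate * (a ^+ 2 - d * d') <= a ^+ 2 + d * d'.
  by rewrite /cone_rate mulrAC ler_pdivrMr //; nra.
have ecr' : cross p q = (a ^+ 2 - d * d') * cross P Q.
  by rewrite -ecr /p' /q' cross_det.
have per0 : 0 <= x * w + y * z by rewrite addr_ge0 ?mulr_ge0.
rewrite exprS -mulrA.
apply: (le_trans (ler_wpM2l lam0 hl)).
have -> : cone_rate * ((x * w + y * z) * cross p q) =
    (cone_rate * (a ^+ 2 - d * d')) * (cross P Q * (x * w + y * z)).
  by rewrite ecr'; ring.
have h1 : cone_rate * (a ^+ 2 - d * d') * (cross P Q * (x * w + y * z)) <=
  (a ^+ 2 + d * d') * (cross P Q * (x * w + y * z)).
  by apply: ler_wpM2r lamle; rewrite mulr_ge0 // ltW.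
apply: (le_trans h1).
rewrite [cross P Q * _]mulrC mulrA; apply: ler_wpM2r; first exact: ltW.
have := mulr_ge0 (mulr_ge0 x0 z0) (mulr_ge0 a0 d0).
have := mulr_ge0 (mulr_ge0 y0 w0) (mulr_ge0 a0 d'0).
by move=> h2 h3; lra.
Qed.

End step.
End growth.

Section unreachable.
Variable R : realType.
Implicit Types (u v w p q y : 'cV[R]_2) (M N E : 'M[R]_2) (c s : R).

Lemma rotmxM c s c' s' u : rotmx c s *m (rotmx c' s' *m u) =
  rotmx (c * c' - s * s') (s * c' + c * s') *m u.
Proof. by apply: eq_cV2; rewrite !(mulmx2E, mx2E); ring. Qed.

Definition sqnmx M := M 0 0 ^+ 2 + M 0 1 ^+ 2 + M 1 0 ^+ 2 + M 1 1 ^+ 2.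

Lemma sqn_mulmx M v : sqn (M *m v) <= sqnmx M * sqn v.
Proof.
rewrite /sqn /sqnmx !mulmx2E.
move: (M 0 0) (M 0 1) (M 1 0) (M 1 1) (v 0 0) (v 1 0) => a b c d x y.
rewrite -subr_ge0.
have -> : (a ^+ 2 + b ^+ 2 + c ^+ 2 + d ^+ 2) * (x ^+ 2 + y ^+ 2) -
  ((a * x + b * y) ^+ 2 + (c * x + d * y) ^+ 2) =
  (a * y - b * x) ^+ 2 + (c * y - d * x) ^+ 2 by ring.
by rewrite addr_ge0 ?sqr_ge0.
Qed.

Lemma sqnmx_ge0 M : 0 <= sqnmx M.
Proof. by rewrite !addr_ge0 ?sqr_ge0. Qed.

Lemma sqnmx_l1norm M : sqnmx M <= l1norm M ^+ 2.
Proof.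
rewrite /sqnmx l1normE2 -(real_normK (num_real (M 0 0))).
rewrite -(real_normK (num_real (M 0 1))) -(real_normK (num_real (M 1 0))).
rewrite -(real_normK (num_real (M 1 1))).
have := normr_ge0 (M 0 0); have := normr_ge0 (M 0 1).
have := normr_ge0 (M 1 0); have := normr_ge0 (M 1 1).
move: `|M 0 0| `|M 0 1| `|M 1 0| `|M 1 1| => a b c d d0 c0 b0 a0.
by have := mulr_ge0 a0 b0; have := mulr_ge0 a0 c0; have := mulr_ge0 a0 d0;
  have := mulr_ge0 b0 c0; have := mulr_ge0 b0 d0; have := mulr_ge0 c0 d0; lra.
Qed.

Lemma ler_sum_sqr (a b m : R) : a ^+ 2 <= m -> b ^+ 2 <= m ->
  (a + b) ^+ 2 <= 4 * m.
Proof. by have := sqr_ge0 (a - b); lra. Qed.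

Lemma cross_sqn_trans M u p P : 
  cross (M *m u) P ^+ 2 <= sqnmx M * (sqn u * sqn P).
Proof.
apply: le_trans (cross_sqn _ _) _; rewrite mulrA ler_wpM2r ?sqn_ge0 //.
exact: sqn_mulmx.
Qed.

(** The last step uses half of the rotation angle. If some direction is still
not reachable with the full angle, the sides of the last cone make an angle
bounded away from half a turn, so that entries in the frame of the last cone
are controlled by the norm of the product and the growth of the permanent
becomes a growth of the norm. *)
Lemma unreachable_growth (ch sh : R) (B : nat -> 'M[R]_2) u y n
   (c := ch ^+ 2 - sh ^+ 2) (s := 2 * sh * ch) :
  0 < ch -> 0 < sh -> ch ^+ 2 + sh ^+ 2 = 1 -> 0 < c ->
  u != 0 -> (forall i, \det (B i) = 1) -> y != 0 -> ~ reach c B u n.+2 y ->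
  cone_rate s ^+ n * (s ^+ 2 * c) <= l1norm (mprod (fun i => B i.+1) n.+1) ^+ 2.
Proof.
move=> ch0 sh0 h1 c0 u0 dB y0 nr.
have s0 : 0 < s by rewrite !mulr_gt0.
have cs1 : c ^+ 2 + s ^+ 2 = 1.
  transitivity ((ch ^+ 2 + sh ^+ 2) ^+ 2); last by rewrite h1 expr1n.
  by rewrite /c /s; ring.
have [all|] := cone_dichotomy c0 s0 cs1 n u0 dB.
  by case: nr; apply: (reachS_all cs1 (dB _) all).
set w := B 0%N *m u.
set p0 := rotmx c (- s) *m w; set q0 := rotmx c s *m w.
move=> [p [q [pq cone [X [Y [Z [W [[X0 Y0] [Z0 W0] eT0 eT1 hl]]]]]]]].
set p' := B n.+1 *m p; set q' := B n.+1 *m q.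
have pq' : 0 < cross p' q' by rewrite /p' /q' cross_det.
have PQ : 0 < cross (rotmx c (- s) *m p') (rotmx c s *m q').
  rewrite ltNge; apply/negP => PQ; apply: nr.
  by apply: (reachS cone) => //; apply: (@widened_cone_full _ c s).
set P := rotmx ch (- sh) *m p'; set Q := rotmx ch sh *m q'.
have shP : rotmx ch sh *m P = p'.
  rewrite /P rotmxM; have -> : ch * ch - sh * - sh = 1 by lra.
  have -> : sh * ch + ch * - sh = 0 by ring.
  exact: rotmx10.
have shQ : rotmx ch (- sh) *m Q = q'.
  rewrite /Q rotmxM; have -> : ch * ch - - sh * sh = 1 by lra.
  have -> : - sh * ch + ch * sh = 0 by ring.
  exact: rotmx10.
have eP : rotmx c (- s) *m p' = rotmx ch (- sh) *m P.
  by rewrite /P rotmxM; congr (rotmx _ _ *m _); rewrite /c /s; ring.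
have eQ : rotmx c s *m q' = rotmx ch sh *m Q.
  by rewrite /Q rotmxM; congr (rotmx _ _ *m _); rewrite /c /s; ring.
set dot := P 0 0 * Q 0 0 + P 1 0 * Q 1 0.
have i1 : s * dot < c * cross P Q.
  move: pq'; rewrite -shP -shQ /cross /dot !(mulmx2E, mx2E) /c /s; lra.
have i2 : - (s * dot) < c * cross P Q.
  move: PQ; rewrite eP eQ /cross /dot !(mulmx2E, mx2E) /c /s; lra.
have PQ0 : 0 < cross P Q.
  by rewrite -(pmulr_rgt0 _ c0); lra.
(* The sine of the angle between P and Q is at least s. *)
have margin : s ^+ 2 * (sqn P * sqn Q) <= cross P Q ^+ 2.
  have h : (s * dot) ^+ 2 <= (c * cross P Q) ^+ 2.
    by rewrite -subr_ge0 subr_sqr mulr_ge0 //; lra.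
  have e : sqn P * sqn Q = cross P Q ^+ 2 + dot ^+ 2.
    by rewrite /sqn /cross /dot; ring.
  rewrite e -[leRHS]mul1r -cs1; move: h; rewrite !exprMn => h; lra.
have PQh : 0 < cross P Q := PQ0.
have [a [d [d' [a0 d0 d'0 ep [eq sa ecr]]]]] := frame_change ch0 sh0 h1 pq' PQh.
rewrite -/P -/Q in ep eq ecr.
set T := mprod _ _.
have T0 : T *m p0 = (X * a + Y * d') *: P + (X * d + Y * a) *: Q.
  rewrite /T /= -mulmxA eT0 mulmxDr -!scalemxAr -/p' -/q' ep eq.
  by apply: eq_cV2; rewrite !lin2E; ring.
have T1 : T *m q0 = (Z * a + W * d') *: P + (Z * d + W * a) *: Q.
  rewrite /T /= -mulmxA eT1 mulmxDr -!scalemxAr -/p' -/q' ep eq.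
  by apply: eq_cV2; rewrite !lin2E; ring.
have crr v : cross v v = 0 by rewrite /cross; ring.
have fX : (X * a + Y * d') * cross P Q = cross (T *m p0) Q.
  by rewrite T0 cross_lin2l crr; ring.
have fW : (Z * d + W * a) * cross P Q = cross P (T *m q0).
  by rewrite T1 cross_lin2r crr; ring.
have fY : (X * d + Y * a) * cross P Q = cross P (T *m p0).
  by rewrite T0 cross_lin2r crr; ring.
have fZ : (Z * a + W * d') * cross P Q = cross (T *m q0) Q.
  by rewrite T1 cross_lin2l crr; ring.
set S := sqnmx T.
have np0 : sqn p0 = sqn w by rewrite /p0 sqn_rotmx // sqrrN.
have nq0 : sqn q0 = sqn w by rewrite /q0 sqn_rotmx.
set m := S ^+ 2 * sqn w ^+ 2 * (sqn P * sqn Q).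
have bnd u1 u2 v1 v2 : sqn u1 = sqn w -> sqn u2 = sqn w -> 
   sqn v1 * sqn v2 = sqn P * sqn Q ->
   (cross (T *m u1) v1 * cross v2 (T *m u2)) ^+ 2 <= m.
  move=> e1 e2 e3; have -> : m = (S * (sqn u1 * sqn v1)) * (S * (sqn u2 * sqn v2)).
    by rewrite e1 e2 /m -e3; ring.
  rewrite exprMn [cross v2 _]crossC sqrrN.
  by apply: ler_pM; rewrite ?sqr_ge0 //; exact: cross_sqn_trans.
have per2 : (((X * a + Y * d') * (Z * d + W * a) + (X * d + Y * a) * (Z * a + W * d'))
    * cross P Q ^+ 2) ^+ 2 <= 4 * m.
  rewrite mulrDl; apply: ler_sum_sqr.
    have -> : (X * a + Y * d') * (Z * d + W * a) * cross P Q ^+ 2 =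
      cross (T *m p0) Q * cross P (T *m q0) by rewrite -fX -fW; ring.
    by apply: bnd => //; rewrite mulrC.
  have -> : (X * d + Y * a) * (Z * a + W * d') * cross P Q ^+ 2 =
      cross (T *m q0) Q * cross P (T *m p0) by rewrite -fY -fZ; ring.
  by apply: bnd => //; rewrite mulrC.
have perm_le : (X * W + Y * Z) * cross p q <=
   ((X * a + Y * d') * (Z * d + W * a) + (X * d + Y * a) * (Z * a + W * d')) * cross P Q.
  have -> : cross p q = (a ^+ 2 - d * d') * cross P Q.
    by rewrite -ecr /p' /q' cross_det.
  rewrite mulrA; apply: ler_wpM2r; first exact: ltW.
  have := mulr_ge0 (mulr_ge0 X0 Z0) (mulr_ge0 a0 d0).
  have := mulr_ge0 (mulr_ge0 Y0 W0) (mulr_ge0 a0 d'0).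
  have := mulr_ge0 (mulr_ge0 X0 W0) (mulr_ge0 d0 d'0).
  have := mulr_ge0 (mulr_ge0 Y0 Z0) (mulr_ge0 d0 d'0).
  by lra.
have w0 : 0 < sqn w.
  apply: sqn_gt0; have ub : B 0%N \in unitmx by rewrite unitmxE dB unitr1.
  by apply: contraNneq u0 => e; rewrite -[u](mulKmx ub) -/w e mulmx0.
have cr0 : cross p0 q0 = 2 * s * c * sqn w.
  by rewrite /cross /sqn /p0 /q0 !(mulmx2E, mx2E); ring.
have s2lt1 : s ^+ 2 < 1 by rewrite -cs1 ltrDr exprn_gt0.
have L0 : 0 < cone_rate s ^+ n.
  by rewrite exprn_gt0 // divr_gt0 ?subr_gt0 // ltr_wpDr ?sqr_ge0.
set L := cone_rate s ^+ n in L0 hl *.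
have PQpos : 0 < sqn P * sqn Q.
  by apply: lt_le_trans (cross_sqn P Q); rewrite exprn_gt0.
have main : (L * (2 * s * c * sqn w)) ^+ 2 * cross P Q ^+ 2 <= 4 * m.
  apply: le_trans per2; rewrite -exprMn.
  rewrite ler_sqr ?nnegrE; last 2 first.
  - by apply: ltW; rewrite !mulr_gt0.
  - by rewrite mulr_ge0 ?sqr_ge0 // addr_ge0 // mulr_ge0 // addr_ge0 // mulr_ge0.
  rewrite [cross P Q ^+ 2]expr2 [leRHS]mulrA; apply: ler_wpM2r; first exact: ltW.
  by rewrite -cr0; apply: le_trans hl perm_le.
have : (L * (s ^+ 2 * c)) ^+ 2 <= S ^+ 2.
  have h4 : (L * (2 * s * c * sqn w)) ^+ 2 * (s ^+ 2 * (sqn P * sqn Q)) <= 4 * m.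
    by apply: le_trans main; apply: ler_wpM2l margin; exact: sqr_ge0.
  rewrite -(@ler_pM2l _ (4 * (sqn w ^+ 2 * (sqn P * sqn Q)))); last first.
    by rewrite mulr_gt0 // mulr_gt0 // exprn_gt0.
  have -> : 4 * (sqn w ^+ 2 * (sqn P * sqn Q)) * (L * (s ^+ 2 * c)) ^+ 2 =
     (L * (2 * s * c * sqn w)) ^+ 2 * (s ^+ 2 * (sqn P * sqn Q)) by ring.
  by have -> : 4 * (sqn w ^+ 2 * (sqn P * sqn Q)) * S ^+ 2 = 4 * m by rewrite /m; ring.
have hS : 0 <= S by exact: sqnmx_ge0.
rewrite ler_sqr ?nnegrE // => [h5|]; last first.
  by rewrite mulr_ge0 ?(ltW L0) // mulr_ge0 ?sqr_ge0 // ltW.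
exact: le_trans h5 (sqnmx_l1norm _).
Qed.
End unreachable.

(** * Cayley rotations and cancellation of growth *)

Section local.
Variable R : realType.
Implicit Types (u v w p q y : 'cV[R]_2) (M N E P Q : 'M[R]_2) (c s t : R).

(** The rotation by the angle 2 arctan t. This rational parametrization replaces
angles and trigonometric functions. *)
Definition cayley t : 'M[R]_2 := rotmx ((1 - t ^+ 2) / (1 + t ^+ 2)) (2 * t / (1 + t ^+ 2)).

Lemma onesqr_gt0 t : 0 < 1 + t ^+ 2.
Proof. by rewrite ltr_wpDr ?sqr_ge0. Qed.

Lemma cayley_unit t :
  ((1 - t ^+ 2) / (1 + t ^+ 2)) ^+ 2 + (2 * t / (1 + t ^+ 2)) ^+ 2 = 1.
Proof. by field; rewrite gt_eqF // onesqr_gt0. Qed.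

Lemma det_cayley t : \det (cayley t) = 1.
Proof. exact/det_rotmx/cayley_unit. Qed.

Lemma cayley0 : cayley 0 = 1%:M.
Proof.
rewrite /cayley expr0n /= subr0 addr0 mulr0 divr1 mul0r.
by apply: eq_mx2; rewrite !mx2E !mxE //= oppr0.
Qed.

Lemma l1norm_cayley t : l1norm (cayley t) <= 4.
Proof.
rewrite l1normE2 !mx2E normrN.
have h (x y : R) : x ^+ 2 + y ^+ 2 = 1 -> `|x| <= 1 /\ `|y| <= 1.
  by move=> e; split; rewrite -(@ler_pXn2r _ 2) ?nnegrE // real_normK ?num_real //
    expr1n -e ?lerDl ?lerDr sqr_ge0.
have [h1 h2] := h _ _ (cayley_unit t); lra.
Qed.

(** The parameter is the tangent of the half angle, s / (1 + c). *)
Lemma rotset_cayley (eta : R) E : 0 < eta ->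
  rotset ((1 - eta ^+ 2) / (1 + eta ^+ 2)) E -> exists2 t, `|t| <= eta & E = cayley t.
Proof.
move=> eta0 [c [s [-> cs1 hc]]].
have e0 := onesqr_gt0 eta.
have c1 : 0 < 1 + c.
  apply: (@lt_le_trans _ _ (1 + (1 - eta ^+ 2) / (1 + eta ^+ 2))); last by rewrite lerD2l.
  have -> : 1 + (1 - eta ^+ 2) / (1 + eta ^+ 2) = 2 / (1 + eta ^+ 2).
    by field; rewrite gt_eqF.
  by rewrite divr_gt0.
have c1N : 1 + c != 0 by rewrite gt_eqF.
have e : s ^+ 2 = 1 - c ^+ 2 by lra.
exists (s / (1 + c)).
  rewrite -(@ler_pXn2r _ 2) ?nnegrE ?(ltW eta0) // real_normK ?num_real //.
  rewrite expr_div_n e ler_pdivrMr ?exprn_gt0 //.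
  have -> : 1 - c ^+ 2 = (1 - c) * (1 + c) by ring.
  rewrite expr2 mulrA ler_pM2r //; move: hc; rewrite ler_pdivrMr //; lra.
have h1 : 1 + (s / (1 + c)) ^+ 2 = 2 / (1 + c) by rewrite expr_div_n e; field.
rewrite /cayley; congr rotmx; rewrite h1.
  by rewrite expr_div_n e; field.
by field.
Qed.

(** Contrapositive of [unreachable_growth] in terms of the parameters of the
rotations. *)
Lemma slow_growth_accessible (eta : R) : 0 < eta -> eta < 1 -> exists2 kappa : R, 0 < kappa &
  exists2 L : R, 1 < L & forall (B : nat -> 'M[R]_2) n u y,
   (forall i, \det (B i) = 1) -> u != 0 -> y != 0 ->
   l1norm (mprod (fun i => B i.+1) n.+1) ^+ 2 < L ^+ n * kappa ->
   exists2 t : nat -> R, (forall i, `|t i| <= eta) & 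
     exists2 r : R, r != 0 & mprod (fun i => cayley (t i) *m B i) n.+2 *m u = r *: y.
Proof.
move=> eta0 eta1.
have e0 := onesqr_gt0 eta.
(* The half angle has tangent [eta], so the full angle has cosine (1 - eta^2) / (1 + eta^2), as in [cayley]. *)
set h := Num.sqrt (1 + eta ^+ 2).
have h0 : 0 < h by rewrite sqrtr_gt0.
have h2 : h ^+ 2 = 1 + eta ^+ 2 by rewrite sqr_sqrtr // ltW.
have hN : h != 0 by rewrite gt_eqF.
set ch := h^-1; set sh := eta / h.
have ch0 : 0 < ch by rewrite invr_gt0.
have sh0 : 0 < sh by rewrite divr_gt0.
have hN2 : 1 + eta ^+ 2 != 0 by rewrite gt_eqF.
have h1 : ch ^+ 2 + sh ^+ 2 = 1.
  by rewrite /ch /sh exprVn expr_div_n h2; field.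
have ec : ch ^+ 2 - sh ^+ 2 = (1 - eta ^+ 2) / (1 + eta ^+ 2).
  by rewrite /ch /sh exprVn expr_div_n h2; field.
have c0 : 0 < ch ^+ 2 - sh ^+ 2.
  by rewrite ec divr_gt0 // subr_gt0 expr_lt1 // ltW.
set s := 2 * sh * ch.
have s0 : 0 < s by rewrite !mulr_gt0.
have cs1 : (ch ^+ 2 - sh ^+ 2) ^+ 2 + s ^+ 2 = 1.
  transitivity ((ch ^+ 2 + sh ^+ 2) ^+ 2); last by rewrite h1 expr1n.
  by rewrite /s; ring.
have s1 : s ^+ 2 < 1 by rewrite -cs1 ltrDr exprn_gt0.
exists (s ^+ 2 * (ch ^+ 2 - sh ^+ 2)); first by rewrite mulr_gt0 // exprn_gt0.
exists (cone_rate s).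
  rewrite /cone_rate ltr_pdivlMr ?subr_gt0 // mul1r.
  by have := exprn_gt0 2 s0; lra.
move=> B n u y dB u0 y0 hl.
have : reach (ch ^+ 2 - sh ^+ 2) B u n.+2 y.
  apply: contrapT => nr.
  have := unreachable_growth ch0 sh0 h1 c0 u0 dB y0 nr.
  by rewrite -/s leNgt hl.
move=> [E hE [r r0 e]].
have /choice[t ht] : forall i, exists t, `|t| <= eta /\ E i = cayley t.
  by move=> i; have := hE i; rewrite ec => /(rotset_cayley eta0)[t]; exists t.
exists t => [i|]; first by case: (ht i).
exists r => //; rewrite -e; congr (_ *m _); apply: eq_mprod => i _.
by case: (ht i) => _ ->.
Qed.

Lemma l1normE_cV v : l1norm v = `|v 0 0| + `|v 1 0|.
Proof.
rewrite /l1norm !big_ord_recl !big_ord0 !addr0.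
by congr (_ + `|v _ _|); apply: val_inj.
Qed.

(** A vector orthogonal to the larger row of [Q] is sent to a vector of size
one, whatever the other row, because the determinant is one. *)
Lemma contracted Q : \det Q = 1 ->
  exists2 s : 'cV[R]_2, s != 0 & l1norm (Q *m s) * l1norm Q <= 2 * l1norm s.
Proof.
move=> dQ; have dQ' := dQ; rewrite det_mx2 in dQ'.
have key (a b : R) (vv : 'cV[R]_2) : vv 0 0 = - b -> vv 1 0 = a ->
   l1norm Q <= 2 * (`|a| + `|b|) -> l1norm (Q *m vv) = 1 -> 
   exists2 s : 'cV[R]_2, s != 0 & l1norm (Q *m s) * l1norm Q <= 2 * l1norm s.
  move=> e0 e1 hQ h1; exists vv.
    apply: contra_eq_neq h1 => ->; rewrite mulmx0 l1normE_cV !mxE normr0 addr0.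
    by rewrite eq_sym oner_eq0.
  by rewrite h1 mul1r l1normE_cV e0 e1 normrN [X in 2 * X]addrC.
have [h|h] := lerP (`|Q 1 0| + `|Q 1 1|) (`|Q 0 0| + `|Q 0 1|).
  apply: (key (Q 0 0) (Q 0 1) (\col_i (if i == 0 then - Q 0 1 else Q 0 0))).
  - by rewrite mxE.
  - by rewrite mxE.
  - by rewrite l1normE2; lra.
  - rewrite l1normE_cV !mulmx2E !mxE /=.
    have -> : Q 0 0 * - Q 0 1 + Q 0 1 * Q 0 0 = 0 by ring.
    have -> : Q 1 0 * - Q 0 1 + Q 1 1 * Q 0 0 = 1 by rewrite -dQ'; ring.
    by rewrite normr0 normr1 add0r.
apply: (key (Q 1 0) (Q 1 1) (\col_i (if i == 0 then - Q 1 1 else Q 1 0))).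
- by rewrite mxE.
- by rewrite mxE.
- by rewrite l1normE2; lra.
- rewrite l1normE_cV !mulmx2E !mxE /=.
  have -> : Q 0 0 * - Q 1 1 + Q 0 1 * Q 1 0 = - 1 by rewrite -dQ'; ring.
  have -> : Q 1 0 * - Q 1 1 + Q 1 1 * Q 1 0 = 0 by ring.
  by rewrite normr0 normrN normr1 addr0.
Qed.

Lemma l1normZ m n (a : R) (M : 'M[R]_(m, n)) : l1norm (a *: M) = `|a| * l1norm M.
Proof.
rewrite /l1norm mulr_sumr; apply: eq_bigr => i _; rewrite mulr_sumr.
by apply: eq_bigr => j _; rewrite mxE normrM.
Qed.

Lemma l1norm_cV_gt0 v : v != 0 -> 0 < l1norm v.
Proof.
move=> v0; rewrite lt_neqAle l1norm_ge0 andbT eq_sym; apply: contra v0.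
rewrite l1normE_cV paddr_eq0 // !normr_eq0 => /andP[/eqP h0 /eqP h1].
by apply/eqP/eq_cV2; rewrite ?h0 ?h1 mxE.
Qed.

Lemma norm_cross u v : `|cross u v| <= l1norm u * l1norm v.
Proof.
rewrite /cross !l1normE_cV; apply: le_trans (ler_normB _ _) _; rewrite !normrM.
have := mulr_ge0 (normr_ge0 (u 0 0)) (normr_ge0 (v 0 0)).
have := mulr_ge0 (normr_ge0 (u 1 0)) (normr_ge0 (v 1 0)); lra.
Qed.

Lemma l1norm_le_cV M (C : R) : (forall w, l1norm (M *m w) <= C * l1norm w) ->
  l1norm M <= 2 * C.
Proof.
move=> h.
pose e0 : 'cV[R]_2 := \col_i (if i == 0 then 1 else 0).
pose e1 : 'cV[R]_2 := \col_i (if i == 0 then 0 else 1).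
have := h e0; have := h e1.
rewrite !l1normE_cV !mulmx2E !mxE /= !(mulr0, mulr1, addr0, add0r, normr0, normr1).
rewrite l1normE2; lra.
Qed.

(** Take [s] contracted by [Q] and [u] contracted by the inverse of [P]. The
second choice means that [P w] stays within distance of order |w| / |P| of
the line of [u]. If [M] maps this line to the line of [s], the component of
[P w] along [u] gains |P| and then loses |Q|, and the other component gains
at most |Q| / |P|. *)
Lemma cancel_growth P Q : \det P = 1 -> \det Q = 1 ->
  exists u, exists2 s : 'cV[R]_2, (u != 0) && (s != 0) & forall M r, M *m u = r *: s ->
    l1norm (Q *m M *m P) <= 
       8 * l1norm M * (l1norm P / l1norm Q + l1norm Q / l1norm P).
Proof.
move=> dP dQ.
have dP' : \det (adj2 P) = 1.
  by move: dP; rewrite !det_mx2 !mx2E => <-; ring.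
have [u u0 hu] := contracted dP'.
have [s s0 hs] := contracted dQ.
exists u, s; first by rewrite u0.
move=> M r e.
have PP : P *m adj2 P = 1%:M by apply: mulmx1C; exact: mul_adj2.
have p1 : 0 < l1norm P := lt_le_trans ltr01 (l1norm_det1 dP).
have q1 : 0 < l1norm Q := lt_le_trans ltr01 (l1norm_det1 dQ).
have u1 := l1norm_cV_gt0 u0; have u2 := sqn_gt0 u0.
rewrite -[8]/(2 * 4)%:R natrM -!mulrA; apply: l1norm_le_cV => w.
set z := P *m w.
pose u' : 'cV[R]_2 := \col_i (if i == 0 then - u 1 0 else u 0 0).
pose alpha := (u 0 0 * z 0 0 + u 1 0 * z 1 0) / sqn u.
pose beta := cross u z / sqn u.
have hz : z = alpha *: u + beta *: u'.
  have := u2; rewrite lt_neqAle eq_sym => /andP[h _]; rewrite /alpha /beta.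
  apply: eq_cV2; rewrite lin2E [u' _ _]mxE /=; move: h; rewrite /sqn /cross => h;
   by field.
have nu : l1norm u' = l1norm u by rewrite !l1normE_cV !mxE /= normrN addrC.
have hsq : l1norm u ^+ 2 <= 2 * sqn u.
  rewrite l1normE_cV /sqn -(real_normK (num_real (u 0 0))).
  rewrite -(real_normK (num_real (u 1 0))).
  by have := sqr_ge0 (`|u 0 0| - `|u 1 0|); lra.
have ha : `|alpha| * l1norm u <= 2 * l1norm P * l1norm w.
  have hz' : l1norm z <= l1norm P * l1norm w by exact: l1normM.
  have hd : `|u 0 0 * z 0 0 + u 1 0 * z 1 0| <= l1norm u * l1norm z.
    rewrite !l1normE_cV; apply: le_trans (ler_normD _ _) _; rewrite !normrM.
    have := mulr_ge0 (normr_ge0 (u 0 0)) (normr_ge0 (z 1 0)).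
    have := mulr_ge0 (normr_ge0 (u 1 0)) (normr_ge0 (z 0 0)); lra.
  rewrite normf_div (gtr0_norm u2) mulrAC ler_pdivrMr //.
  apply: le_trans (ler_wpM2r (ltW u1) hd) _.
  rewrite mulrAC -expr2.
  apply: le_trans (ler_wpM2r (l1norm_ge0 z) hsq) _.
  have -> : 2 * l1norm P * l1norm w * sqn u = 2 * sqn u * (l1norm P * l1norm w) by ring.
  by apply: ler_wpM2l hz'; rewrite mulr_ge0 // ltW.
have hb : `|beta| * l1norm u * l1norm P <= 4 * l1norm w.
  have hc : `|cross u z| <= l1norm (adj2 P *m u) * l1norm w.
    have -> : cross u z = cross (adj2 P *m u) w.
      by rewrite -[RHS](cross_det _ _ dP) mulmxA PP mul1mx.
    exact: norm_cross.
  rewrite l1norm_adj2 in hu.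
  rewrite normf_div (gtr0_norm u2).
  have -> : `|cross u z| / sqn u * l1norm u * l1norm P =
     `|cross u z| * l1norm P * l1norm u / sqn u by field; rewrite gt_eqF.
  rewrite ler_pdivrMr //.
  have h3 : `|cross u z| * l1norm P <= 2 * l1norm u * l1norm w.
    apply: le_trans (ler_wpM2r (ltW p1) hc) _.
    by rewrite mulrAC; apply: ler_wpM2r; [exact: l1norm_ge0|].
  apply: le_trans (ler_wpM2r (ltW u1) h3) _.
  have -> : 2 * l1norm u * l1norm w * l1norm u = 2 * l1norm w * l1norm u ^+ 2 by ring.
  have -> : 4 * l1norm w * sqn u = 2 * l1norm w * (2 * sqn u) by ring.
  by apply: ler_wpM2l hsq; rewrite mulr_ge0 // l1norm_ge0.
have M0 := l1norm_ge0 M; have w0 := l1norm_ge0 w.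
have -> : Q *m M *m P *m w = alpha *: (Q *m (M *m u)) + beta *: (Q *m (M *m u')).
  by rewrite -!mulmxA -/z hz !mulmxDr -!scalemxAr.
apply: le_trans (l1normD _ _) _; rewrite !l1normZ.
have t1 : `|alpha| * l1norm (Q *m (M *m u)) <= 4 * (l1norm M * (l1norm P / l1norm Q)) * l1norm w.
  rewrite e -scalemxAr l1normZ.
  have hrs : `|r| * l1norm s <= l1norm M * l1norm u by rewrite -l1normZ -e; exact: l1normM.
  rewrite !mulrA [leRHS]mulrAC ler_pdivlMr //.
  have -> : `|alpha| * `|r| * l1norm (Q *m s) * l1norm Q =
     (`|alpha| * `|r|) * (l1norm (Q *m s) * l1norm Q) by ring.
  apply: le_trans (ler_wpM2l _ hs) _; first by rewrite mulr_ge0.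
  have -> : `|alpha| * `|r| * (2 * l1norm s) = (2 * `|alpha|) * (`|r| * l1norm s) by ring.
  apply: le_trans (ler_wpM2l _ hrs) _; first by rewrite mulr_ge0.
  have -> : 2 * `|alpha| * (l1norm M * l1norm u) = (2 * l1norm M) * (`|alpha| * l1norm u) by ring.
  apply: le_trans (ler_wpM2l _ ha) _; first by rewrite mulr_ge0.
  by rewrite le_eqVlt; apply/orP; left; apply/eqP; ring.
have t2 : `|beta| * l1norm (Q *m (M *m u')) <= 4 * (l1norm M * (l1norm Q / l1norm P)) * l1norm w.
  rewrite !mulrA [leRHS]mulrAC ler_pdivlMr //.
  have h4 : l1norm (Q *m (M *m u')) <= l1norm Q * (l1norm M * l1norm u).
    rewrite -nu; apply: le_trans (l1normM _ _) _.
    by apply: ler_wpM2l (l1normM _ _); exact: ltW.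
  have -> : `|beta| * l1norm (Q *m (M *m u')) * l1norm P =
    (`|beta| * l1norm P) * l1norm (Q *m (M *m u')) by ring.
  apply: le_trans (ler_wpM2l _ h4) _; first by rewrite mulr_ge0 // ltW.
  have -> : `|beta| * l1norm P * (l1norm Q * (l1norm M * l1norm u)) =
    (l1norm Q * l1norm M) * (`|beta| * l1norm u * l1norm P) by ring.
  apply: le_trans (ler_wpM2l _ hb) _; first by rewrite mulr_ge0 // ltW.
  by rewrite le_eqVlt; apply/orP; left; apply/eqP; ring.
apply: le_trans (lerD t1 t2) _.
by rewrite le_eqVlt; apply/orP; left; apply/eqP; ring.
Qed.

End local.

(** * Perturbed products along one orbit segment *)

Section program.
Variable R : realType.
Implicit Types (u v : 'cV[R]_2) (M P Q : 'M[R]_2) (t : nat -> R).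

Lemma l1norm1 : l1norm (1%:M : 'M[R]_2) = 2.
Proof. by rewrite l1normE2 !mxE /= normr0 normr1; ring. Qed.

Lemma l1norm_mprod (B : nat -> 'M[R]_2) (C : R) n : 0 <= C ->
  (forall i, (i < n)%N -> l1norm (B i) <= C) -> l1norm (mprod B n) <= 2 * C ^+ n.
Proof.
move=> C0; elim: n => [|n IH] h /=; first by rewrite l1norm1 expr0 mulr1.
apply: le_trans (l1normM _ _) _; rewrite exprS mulrCA.
apply: ler_pM; rewrite ?l1norm_ge0 ?h //.
by apply: IH => i ilt; apply: h; exact: ltnW.
Qed.

Definition perturb t (B : nat -> 'M[R]_2) i := cayley (t i) *m B i.

Lemma perturb0 B i : perturb (fun=> 0) B i = B i.
Proof. by rewrite /perturb cayley0 mul1mx. Qed.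

(** Every direction can be sent to every direction by small rotations along the
first [m] matrices. *)
Definition accessible (eta : R) (B : nat -> 'M[R]_2) m := forall u v,
  u != 0 -> v != 0 -> exists2 t, (forall i, `|t i| <= eta) &
    exists2 r : R, r != 0 & mprod (perturb t B) m *m u = r *: v.

Lemma l1norm_factor M P (D : R) : \det M = 1 -> l1norm M <= D ->
  l1norm (M *m P) <= D * l1norm P /\ l1norm P <= D * l1norm (M *m P).
Proof.
move=> dM hM; split.
  by apply: le_trans (l1normM _ _) _; apply: ler_wpM2r hM; exact: l1norm_ge0.
have {1}-> : P = adj2 M *m (M *m P) by rewrite mulmxA mul_adj2 // mul1mx.
apply: le_trans (l1normM _ _) _; rewrite l1norm_adj2.
by apply: ler_wpM2r hM; exact: l1norm_ge0.
Qed.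

Lemma l1norm_factorr M P (D : R) : \det M = 1 -> l1norm M <= D ->
  l1norm (P *m M) <= D * l1norm P /\ l1norm P <= D * l1norm (P *m M).
Proof.
move=> dM hM; split.
  by apply: le_trans (l1normM _ _) _; rewrite mulrC; apply: ler_wpM2r hM; exact: l1norm_ge0.
have {1}-> : P = (P *m M) *m adj2 M.
  by rewrite -mulmxA (mulmx1C (mul_adj2 dM)) mulmx1.
apply: le_trans (l1normM _ _) _; rewrite l1norm_adj2 mulrC.
by apply: ler_wpM2r hM; exact: l1norm_ge0.
Qed.

Lemma mprod_tail (B : nat -> 'M[R]_2) n k l : (k <= l)%N -> (l <= n)%N ->
  mprod (fun i => B (i + k)%N) (n - k) =
  mprod (fun i => B (i + l)%N) (n - l) *m mprod (fun i => B (i + k)%N) (l - k).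
Proof.
move=> kl ln; have -> : (n - k = (l - k) + (n - l))%N by lia.
rewrite mprodD; congr (_ *m _); apply: eq_mprod => i _.
by rewrite -addnA subnK.
Qed.

(** Inserting rotations only during the times k, ..., k + m - 1. *)
Lemma mprod_splice t (B : nat -> 'M[R]_2) n k m : (k + m <= n)%N ->
  mprod (perturb (fun i => if (k <= i < k + m)%N then t (i - k)%N else 0) B) n =
  mprod (fun i => B (i + (k + m))%N) (n - (k + m)) *m
    mprod (perturb t (fun i => B (i + k)%N)) m *m mprod B k.
Proof.
move=> kmn; rewrite -{1}(subnKC kmn) -addnA !mprodD.
congr (_ *m _ *m _); apply: eq_mprod => i ik; rewrite /perturb.
- have -> : (k <= i + m + k < k + m)%N = false by lia.
  by rewrite cayley0 mul1mx; congr B; lia.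
- by rewrite leq_addl addnC ltn_add2l ik addKn.
- by rewrite leqNgt ik cayley0 mul1mx.
Qed.

(** The norms of the products before and after a time k are balanced at the
first k where the former is at least half of the latter. An accessible
segment begins less than [T] steps later, and moving to it changes the two
norms by bounded factors; then [cancel_growth] applies. If there is no room
left for that segment, the whole product is already bounded and no rotation
is needed. *)
Lemma bounded_program (eta C : R) (m T : nat) : 0 <= eta -> 1 <= C ->
  exists C0 : R, forall (B : nat -> 'M[R]_2) n,
    (forall i, \det (B i) = 1) -> (forall i, l1norm (B i) <= C) ->
    (forall k, exists2 k', (k <= k' < k + T)%N &
       accessible eta (fun i => B (i + k')%N) m) ->
    exists2 t, (forall i, `|t i| <= eta) & l1norm (mprod (perturb t B) n) <= C0.
Proof.
move=> eta0 C1.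
have C0 : 0 <= C := le_trans ler01 C1.
pose D := 2 * C ^+ (T + m).
have D0 : 0 <= D by rewrite mulr_ge0 // exprn_ge0.
pose F := 2 * C ^+ 2 * D ^+ 2.
pose G := 8 * (2 * (4 * C) ^+ m) * (F + F).
exists (G + D * (2 * C ^+ 2 * D)) => B n dB hB acc.
pose P k := mprod B k.
pose Q k := mprod (fun i => B (i + k)%N) (n - k).
have dP k : \det (P k) = 1 by exact: det_mprod.
have dQ k : \det (Q k) = 1 by apply: det_mprod => i; exact: dB.
have P1 k : 0 < l1norm (P k) := lt_le_trans ltr01 (l1norm_det1 (dP k)).
have Q1 k : 0 < l1norm (Q k) := lt_le_trans ltr01 (l1norm_det1 (dQ k)).
have exk : exists k, (k <= n)%N && (l1norm (Q k) <= 2 * l1norm (P k)).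
  exists n; rewrite leqnn /= /Q subnn /= l1norm1 -[leLHS]mulr1.
  by apply: ler_wpM2l => //; exact: l1norm_det1.
have [k /andP[kn hk] kmin] := ex_minnP exk.
have C2 : 1 <= C ^+ 2 by rewrite exprn_ege1.
have hk' : l1norm (P k) <= 2 * C ^+ 2 * l1norm (Q k).
  have [k0|k0] := posnP k.
    rewrite k0 /P /= l1norm1 -mulrA -[leLHS]mulr1 ler_wpM2l //.
    by apply: mulr_ege1 => //; exact: l1norm_det1.
  have kE : k = k.-1.+1 by rewrite prednK.
  have hlt : 2 * l1norm (P k.-1) <= l1norm (Q k.-1).
    have := contra (kmin k.-1); rewrite -ltnNge ltn_predL k0 => /(_ isT).
    rewrite (leq_trans (leq_pred _) kn) /= -ltNge; exact: ltW.
  have e1 : P k = B k.-1 *m P k.-1 by rewrite {1}kE.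
  have e2 : Q k.-1 = Q k *m B k.-1.
    rewrite /Q (mprod_tail B (leq_pred k) kn); congr (_ *m _).
    by rewrite {1 2 3}kE subSnn /= mulmx1 add0n.
  have [h1 _] := l1norm_factor (P k.-1) (dB k.-1) (hB k.-1).
  have [h2 _] := l1norm_factorr (Q k) (dB k.-1) (hB k.-1).
  rewrite e1; apply: (le_trans h1).
  have h3 : l1norm (P k.-1) <= C * l1norm (Q k).
    rewrite -e2 in h2; apply: le_trans h2; apply: le_trans hlt.
    by rewrite ler_peMl ?ler1n // ltW.
  apply: (le_trans (ler_wpM2l C0 h3)).
  rewrite mulrA -expr2 -mulrA ler_peMl ?ler1n // mulr_ge0 ?(ltW (Q1 _)) //.
  exact: exprn_ge0.
have bndB i l : (l <= T + m)%N -> l1norm (mprod (fun j => B (j + i)%N) l) <= D.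
  move=> lT; apply: (le_trans (l1norm_mprod C0 _)) => [j _|]; first exact: hB.
  by rewrite ler_wpM2l // ler_weXn2l.
have dBB i l : \det (mprod (fun j => B (j + i)%N) l) = 1.
  by apply: det_mprod => j; exact: dB.
have [k' /andP[kk' k'T] ack] := acc k.
have G0 : 0 <= G.
  by rewrite /G /F !mulr_ge0 ?addr_ge0 ?mulr_ge0 ?exprn_ge0 ?mulr_ge0.
have [ln|ln] := ltnP n (k' + m).
  exists (fun=> 0) => [i|]; first by rewrite normr0.
  rewrite (@eq_mprod _ _ B); last by move=> i _; rewrite perturb0.
  rewrite -(subnKC kn) mprodD; apply: (le_trans (l1normM _ _)).
  have hQ : l1norm (Q k) <= D by apply: bndB; clear -ln kk' k'T; lia.
  apply: (@le_trans _ _ (D * (2 * C ^+ 2 * D))); last by rewrite lerDr.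
  apply: ler_pM => //; rewrite ?l1norm_ge0 //.
  apply: (le_trans hk'); apply: ler_wpM2l => //.
  by rewrite mulr_ge0 ?exprn_ge0.
have [u [s /andP[u0 s0] hc]] := cancel_growth (dP k') (dQ (k' + m)%N).
have [t ht [r r0 er]] := ack _ _ u0 s0.
exists (fun i => if (k' <= i < k' + m)%N then t (i - k')%N else 0) => [i|].
  by case: ifP => // _; rewrite normr0.
rewrite (mprod_splice t B ln) -/(Q _) -/(P _).
set M := mprod (perturb t _) m in er *.
have hM : l1norm M <= 2 * (4 * C) ^+ m.
  apply: l1norm_mprod => [|i _]; first by rewrite mulr_ge0.
  apply: (le_trans (l1normM _ _)); apply: ler_pM; rewrite ?l1norm_ge0 //.
  exact: l1norm_cayley.
have pP : P k' = mprod (fun i => B (i + k)%N) (k' - k) *m P k.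
  by rewrite /P -(mprodD B k (k' - k)) subnKC.
have qQ : Q k = Q (k' + m)%N *m mprod (fun i => B (i + k)%N) (k' + m - k).
  by apply: mprod_tail; rewrite // (leq_trans kk') // leq_addr.
have l1 : (k' - k <= T + m)%N by clear -kk' k'T; lia.
have l2 : (k' + m - k <= T + m)%N by clear -kk' k'T; lia.
have [a1 a2] := l1norm_factor (P k) (dBB k (k' - k)%N) (bndB k (k' - k)%N l1).
have [b1 b2] := l1norm_factorr (Q (k' + m)%N) (dBB k (k' + m - k)%N) (bndB k (k' + m - k)%N l2).
rewrite -pP in a1 a2; rewrite -qQ in b1 b2.
have f1 : l1norm (P k') / l1norm (Q (k' + m)%N) <= F.
  rewrite ler_pdivrMr //; apply: (le_trans a1).
  apply: (le_trans (ler_wpM2l D0 hk')).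
  have -> : F * l1norm (Q (k' + m)%N) = D * (2 * C ^+ 2 * (D * l1norm (Q (k' + m)%N))).
    by rewrite /F; ring.
  by apply: ler_wpM2l => //; apply: ler_wpM2l b1; rewrite mulr_ge0 ?exprn_ge0.
have f2 : l1norm (Q (k' + m)%N) / l1norm (P k') <= F.
  rewrite ler_pdivrMr //; apply: (le_trans b2).
  apply: (le_trans (ler_wpM2l D0 hk)).
  have -> : F * l1norm (P k') = C ^+ 2 * (D * (2 * (D * l1norm (P k')))).
    by rewrite /F; ring.
  apply: (@le_trans _ _ (D * (2 * (D * l1norm (P k'))))).
    by apply: ler_wpM2l => //; apply: ler_wpM2l.
  by rewrite ler_peMl //; do 3![apply: mulr_ge0 => //]; exact: l1norm_ge0.
apply: (le_trans (hc _ _ er)).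
apply: (@le_trans _ _ G); last by rewrite lerDl !mulr_ge0 ?exprn_ge0.
rewrite /G; apply: ler_pM.
- by rewrite mulr_ge0 ?l1norm_ge0.
- by rewrite addr_ge0 // divr_ge0 // l1norm_ge0.
- by rewrite ler_wpM2l.
- exact: lerD.
Qed.

End program.

(** * Compactness and minimality *)

Section compactK.
Variable (K : topologicalType).
Hypothesis cK : compact [set: K].

(** A finite subcover for a neighbourhood assignment, obtained from the filter
of sequences containing a given finite one. *)
Lemma compact_fincover (P : K -> set K) : (forall y, nbhs y (P y)) ->
  exists s : seq K, forall x, exists2 y, y \in s & P y x.
Proof.
move=> nP.
pose F : set_system (seq K) :=
  [set S | exists s0 : seq K, forall s : seq K, {subset s0 <= s} -> S s].
have FF : Filter F.
  split.
  - by exists [::].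
  - move=> S1 S2 [s1 h1] [s2 h2]; exists (s1 ++ s2) => s hs; split.
      by apply: h1 => x xs; apply: hs; rewrite mem_cat xs.
    by apply: h2 => x xs; apply: hs; rewrite mem_cat xs orbT.
  - by move=> S1 S2 h12 [s hs]; exists s => s' /hs /h12.
have /compact_near_coveringP cov := cK.
have := cov (seq K) F (fun s x => exists2 y, y \in s & P y x) FF.
case.
  move=> x _; exists (P x, [set s : seq K | x \in s]) => /=.
    split; first exact: nP.
    by exists [:: x] => s; apply; rewrite mem_head.
  by move=> [x' s] /= [h1 h2]; exists x.
by move=> s hs; exists s => x; apply: (hs s).
Qed.

Section real.
Variable R : realType.
Implicit Type h : K -> R.

Lemma nbhs_lt h (b : R) x : continuous h -> h x < b -> nbhs x [set y | h y < b].
Proof.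
move=> ch hx; apply: (ch x [set z | z < b]); exact: lt_nbhsl.
Qed.

Lemma nbhs_gt h (b : R) x : continuous h -> b < h x -> nbhs x [set y | b < h y].
Proof.
move=> ch hx; apply: (ch x [set z | b < z]); exact: lt_nbhsr.
Qed.

Lemma compact_ubound h : continuous h -> exists2 M, 0 < M & forall x, h x <= M.
Proof.
move=> ch.
have [|s hs] := @compact_fincover (fun y => [set x | h x < h y + 1]).
  by move=> y; apply: nbhs_lt => //; rewrite ltrDl.
exists (1 + \sum_(y <- s) (`|h y| + 1)).
  by rewrite ltr_pwDl // sumr_ge0 // => y _; rewrite addr_ge0.
move=> x; have [y ys /= hx] := hs x.
apply: ltW; apply: (lt_le_trans hx).
apply: (@le_trans _ _ (\sum_(y <- s) (`|h y| + 1))); last by rewrite lerDr.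
rewrite (big_rem y) //=.
have : 0 <= \sum_(z <- rem y s) (`|h z| + 1) by apply: sumr_ge0 => z _; rewrite addr_ge0.
have := ler_norm (h y); lra.
Qed.

(** Apply the boundedness of continuous functions to 1 / (b - h). *)
Lemma compact_lt_margin h (b : R) : continuous h -> (forall x, h x < b) ->
  exists2 d : R, 0 < d & forall x, h x <= b - d.
Proof.
move=> ch hb.
have ci : continuous (fun x => (b - h x)^-1).
  move=> x; apply: (@continuousV _ _ (fun x => b - h x)).
    by rewrite gt_eqF // subr_gt0.
  by apply: continuousB; [exact: cst_continuous | exact: ch].
have [M M0 hM] := compact_ubound ci.
exists M^-1; first by rewrite invr_gt0.
move=> x; have b0 : 0 < b - h x by rewrite subr_gt0.
have : M^-1 <= b - h x by rewrite -[leRHS]invrK lef_pV2 ?posrE ?invr_gt0.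
lra.
Qed.

End real.
End compactK.

Section homeoK.
Variables (K : topologicalType) (f : homeo K K).

Lemma iter_continuous (g : K -> K) n : continuous g -> continuous (iter n g).
Proof.
move=> cg; elim: n => [|n IH] x; first exact: cvg_id.
by apply: (@continuous_comp _ _ _ (iter n g) g); [exact: IH | exact: cg].
Qed.

Lemma homeo_iterK n : cancel (iter n f) (iter n (homeo_inv f)).
Proof.
by elim: n => // n IH x; rewrite iterSr /= homeo_funK IH.
Qed.

Lemma homeo_iter_invK n : cancel (iter n (homeo_inv f)) (iter n f).
Proof.
by elim: n => // n IH x; rewrite iterSr /= homeo_invK IH.
Qed.

Lemma iter_inv_iter a b x : (b <= a)%N ->
  iter b (homeo_inv f) (iter a f x) = iter (a - b) f x.
Proof.
by move=> ba; rewrite -{1}(subnKC ba) iterD homeo_iterK.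
Qed.

Lemma ziter_continuous n : continuous (ziter f n).
Proof.
case: n => n; apply: iter_continuous; first exact: homeo_continuous.
exact: homeo_inv_continuous.
Qed.

Lemma minimal_visit (O : set K) x : minimal f -> open O -> O !=set0 ->
  exists n, O (ziter f n x).
Proof. by move=> mf oO O0; have [y [Oy [n _ e]]] := mf x O O0 oO; exists n; rewrite e. Qed.

(** Two-sided density suffices: by compactness bounded positive or negative
times are enough, and they all become nonnegative after starting further
along the orbit. *)
Lemma syndetic (O : set K) : compact [set: K] -> minimal f ->
  open O -> O !=set0 -> exists T, forall x, exists2 k, (k < T)%N & O (iter k f x).
Proof.
move=> cK mf oO O0.
have /choice[n hn] : forall x, exists n, O (ziter f n x).
  by move=> x; exact: minimal_visit.
have [|s hs] := @compact_fincover _ cK (fun y => [set x | O (ziter f (n y) x)]).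
  move=> y; apply: (ziter_continuous (n := n y)).
  by apply: open_nbhs_nbhs; split.
pose N := (\sum_(y <- s) `|n y|%N)%N.
exists (2 * N).+1 => x; have [y ys /= hO] := hs (iter N f x).
have nN : (`|n y| <= N)%N by rewrite /N (big_rem y) //= leq_addr.
case: (n y) hO nN => k /= hO kN.
  by exists (k + N)%N; [lia | rewrite iterD].
exists (N - k.+1)%N; first by lia.
by move: hO; rewrite -iterS iter_inv_iter.
Qed.

End homeoK.

(** * Slow orbit segments *)

Section cts.
Variables (R : realType) (K : topologicalType).
Implicit Types (h : K -> R) (F G : K -> 'M[R]_2).

Lemma exprn_unbounded (q M : R) : 1 < q -> exists N : nat, forall n, (N <= n)%N -> M < q ^+ n.
Proof.
move=> q1; have q0 : 0 < q - 1 by rewrite subr_gt0.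
have bern n : 1 + n%:R * (q - 1) <= q ^+ n.
  elim: n => [|n IH]; first by rewrite mul0r addr0 expr0.
  rewrite exprS -natr1; have n0 : 0 <= n%:R :> R by [].
  have h1 := mulr_ge0 n0 (sqr_ge0 (q - 1)).
  apply: (le_trans _ (ler_wpM2l (ltW (lt_trans ltr01 q1)) IH)).
  have -> : q * (1 + n%:R * (q - 1)) = 1 + (n%:R + 1) * (q - 1) + n%:R * (q - 1) ^+ 2 by ring.
  by rewrite lerDl.
exists (Num.bound (`|M| / (q - 1))) => n hn.
apply: lt_le_trans (bern n).
have : `|M| / (q - 1) < n%:R.
  apply: lt_le_trans (archi_boundP _) _; first by rewrite divr_ge0 // ltW.
  by rewrite ler_nat.
by rewrite ltr_pdivrMr //; have := ler_norm M; lra.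
Qed.

(** Equivalent to continuity for the norm of matrices, but more convenient for
products. *)
Definition entrywise_continuous F := forall i j, continuous (fun x => F x i j).

Lemma entrywise_continuousM F G : entrywise_continuous F -> entrywise_continuous G -> entrywise_continuous (fun x => F x *m G x).
Proof.
move=> cF cG i j.
have -> : (fun x => (F x *m G x) i j) = (fun x => F x i 0 * G x 0 j + F x i 1 * G x 1 j).
  by apply/funext => x; exact: mulmx2E.
move=> x; apply: (@continuousD _ _ _ (fun x => F x i 0 * G x 0 j) (fun x => F x i 1 * G x 1 j)).
  exact: continuousM (cF i 0 x) (cG 0 j x).
exact: continuousM (cF i 1 x) (cG 1 j x).
Qed.

Lemma entrywise_continuous_cst M : entrywise_continuous (fun=> M).
Proof. by move=> i j; exact: cst_continuous. Qed.

Lemma entrywise_continuous_comp F (g : K -> K) : continuous g -> entrywise_continuous F -> entrywise_continuous (F \o g).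
Proof.
by move=> cg cF i j x; apply: (@continuous_comp _ _ _ g (fun x => F x i j));
  [exact: cg | exact: cF].
Qed.

Lemma l1norm_continuous F : entrywise_continuous F -> continuous (fun x => l1norm (F x)).
Proof.
move=> cF.
have -> : (fun x => l1norm (F x)) = (fun x => `|F x 0 0| + `|F x 0 1| + (`|F x 1 0| + `|F x 1 1|)).
  by apply/funext => x; exact: l1normE2.
have cn i j : continuous (fun x => `|F x i j|).
  by move=> x; apply: (@continuous_comp _ _ _ (fun x => F x i j) Num.norm);
    [exact: cF | exact: norm_continuous].
move=> x.
apply: (@continuousD _ _ _ (fun x => `|F x 0 0| + `|F x 0 1|) (fun x => `|F x 1 0| + `|F x 1 1|)).
  by apply: (@continuousD _ _ _ (fun x => `|F x 0 0|)); exact: cn.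
by apply: (@continuousD _ _ _ (fun x => `|F x 1 0|)); exact: cn.
Qed.

Lemma entrywise_continuous_mprod (G : nat -> K -> 'M[R]_2) n :
  (forall i, entrywise_continuous (G i)) -> entrywise_continuous (fun x => mprod (fun i => G i x) n).
Proof.
move=> cG; elim: n => [|n IH] /=; first exact: entrywise_continuous_cst.
exact: entrywise_continuousM.
Qed.

Lemma entrywise_continuousP F : entrywise_continuous F -> continuous F.
Proof.
move=> cF x; apply/cvg_ballP => e e0.
have h i j : \forall t \near x, ball (F x i j) e (F t i j).
  by have /cvg_ballP := cF i j x; apply.
near=> t; split=> // i j; case: (ord2P i) => ->; case: (ord2P j) => ->; near: t; exact: h.
Unshelve. all: by end_near. Qed.

Lemma continuous_entrywise F : continuous F -> entrywise_continuous F.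
Proof.
move=> cF i j x; apply: (@continuous_comp _ _ _ F (fun M : 'M[R]_2 => M i j)); first exact: cF.
exact: coord_continuous.
Qed.

End cts.

Section dyn.
Variables (R : realType) (K : topologicalType) (f : homeo K K).
Hypotheses (cK : compact [set: K]) (mf : minimal f).
Variable g : K -> 'M[R]_2.
Hypotheses (cg : entrywise_continuous g) (dg : forall x, \det (g x) = 1).

(** The sequence of matrices met by the cocycle along the forward orbit of [x]. *)
Definition orbmx (g : K -> 'M[R]_2) x i := g (iter i f x).

Lemma entrywise_continuous_orbmx i : entrywise_continuous (fun x => orbmx g x i).
Proof.
apply: entrywise_continuous_comp => //; apply: iter_continuous; exact: homeo_continuous.
Qed.

Lemma l1norm_bound : exists2 C : R, 1 <= C & forall x, l1norm (g x) <= C.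
Proof.
have [M M0 hM] := compact_ubound cK (l1norm_continuous cg).
by exists (1 + M) => [|x]; [rewrite lerDl ltW | rewrite (le_trans (hM x)) // lerDr].
Qed.

(** What the failure of uniform hyperbolicity provides: at every exponential
rate, arbitrarily long orbit segments that grow more slowly. *)
Definition slow_segments := forall (q : R) N, 1 < q -> exists x n,
  (N <= n)%N /\ l1norm (mprod (orbmx g x) n) < 4 * q ^+ n.

Hypothesis hslow : slow_segments.

(** A slow segment forces accessibility by [slow_growth_accessible]. The
required inequality on the norm is open in the initial point, so that
accessible segments start in a nonempty open set, which every orbit visits.
The inequality concerns the product without its first factor, hence the
shift by [f]. *)
Lemma accessible_orbit (eta : R) : 0 < eta -> eta < 1 -> exists m T, forall x,
  exists2 k, (k < T)%N & accessible eta (orbmx g (iter k f x)) m.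
Proof.
move=> eta0 eta1.
have [kappa k0 [L L1 acc]] := slow_growth_accessible eta0 eta1.
have L0 : 0 < L := lt_trans ltr01 L1.
(* The square of a product of length n that is slow at rate q grows at rate p = q^2, much below L = p^2. *)
set p := Num.sqrt L; set q := Num.sqrt p.
have p2 : p ^+ 2 = L by rewrite sqr_sqrtr // ltW.
have p0 : 0 < p by rewrite sqrtr_gt0.
have p1 : 1 < p by rewrite -(@ltr_pXn2r _ 2) ?nnegrE ?(ltW p0) // p2 expr1n.
have q2 : q ^+ 2 = p by rewrite sqr_sqrtr // ltW.
have q0 : 0 < q by rewrite sqrtr_gt0.
have q1 : 1 < q by rewrite -(@ltr_pXn2r _ 2) ?nnegrE ?(ltW q0) // q2 expr1n.
have [N hN] := exprn_unbounded (16 * p / kappa) p1.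
have [x [[|n] [nN hx]]] := hslow N.+1 q1; first by [].
pose O := [set z | l1norm (mprod (orbmx g z) n.+1) < 4 * q ^+ n.+1].
have cO : continuous (fun z => l1norm (mprod (orbmx g z) n.+1)).
  by apply: l1norm_continuous; apply: entrywise_continuous_mprod => i; exact: entrywise_continuous_orbmx.
pose O' := [set z | O (f z)].
have oO' : open O'.
  rewrite openE => z Oz.
  by apply: (@homeo_continuous _ _ f z); exact: nbhs_lt.
have [|T hT] := syndetic cK mf oO'.
  by exists (homeo_inv f x); rewrite /O' /= homeo_invK.
exists n.+2, T => z; have [k kT hk] := hT z; exists k => // u v u0 v0.
apply: acc => //; first by move=> i; exact: dg.
have -> : mprod (fun i => orbmx g (iter k f z) i.+1) n.+1 =
   mprod (orbmx g (f (iter k f z))) n.+1.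
  by apply: eq_mprod => i _; rewrite /orbmx iterSr.
set a := l1norm _; have a0 : 0 <= a by exact: l1norm_ge0.
have ha : a < 4 * q ^+ n.+1 by exact: hk.
apply: (@lt_trans _ _ ((4 * q ^+ n.+1) ^+ 2)); first by rewrite ltr_pXn2r // nnegrE // ltW // (le_lt_trans a0).
have -> : (4 * q ^+ n.+1) ^+ 2 = 16 * p * p ^+ n.
  by rewrite exprMn [(q ^+ _) ^+ 2]exprAC q2 [p ^+ n.+1]exprS mulrA; congr (_ * _ * _); ring.
have -> : L ^+ n * kappa = p ^+ n * kappa * p ^+ n.
  by rewrite -p2 exprAC expr2 mulrAC.
rewrite ltr_pM2r ?exprn_gt0 // -ltr_pdivrMr //; exact: hN.
Qed.

Lemma orbit_program (eta : R) : 0 < eta -> eta < 1 -> exists C0 : R, forall x n,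
  exists2 t, (forall i, `|t i| <= eta) &
    l1norm (mprod (perturb t (orbmx g x)) n) <= C0.
Proof.
move=> eta0 eta1.
have [C C1 hC] := l1norm_bound.
have [m [T acc]] := accessible_orbit eta0 eta1.
have [C0 hC0] := bounded_program m T (ltW eta0) C1.
exists C0 => x n; apply: hC0 => [i|i|k]; [exact: dg|exact: hC|].
have [j jT hj] := acc (iter k f x).
exists (j + k)%N; first by lia.
have -> // : (fun i => orbmx g x (i + (j + k))%N) = orbmx g (iter j f (iter k f x)).
by apply/funext => i; rewrite /orbmx !iterD.
Qed.

End dyn.

(** * Truncation and distance to the integers *)

Section realfun.
Variable R : realType.

Lemma lipschitz1_continuous (h : R -> R) :
  (forall a b, `|h a - h b| <= `|a - b|) -> continuous h.
Proof.
move=> hl x; apply/cvgrPdist_lt => e e0; near=> t.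
apply: le_lt_trans (hl _ _) _; near: t.
by move: e e0; apply/cvgrPdist_lt; exact: cvg_id.
Unshelve. all: by end_near. Qed.

Definition clamp (z : R) := Num.min 1 (Num.max 0 z).

Lemma clamp_continuous : continuous clamp.
Proof.
apply: lipschitz1_continuous => a b.
have h1 := ler_norm (a - b); have h2 := ler_norm (b - a); rewrite distrC in h2.
rewrite ler_norml /clamp; move: `|a - b| h1 h2 => d h1 h2.
rewrite !minEle !maxEle.
by case: (lerP 0 a) => ?; case: (lerP 0 b) => ?; case: (lerP 1 a) => ?;
  case: (lerP 1 b) => ?; rewrite ?ler10; apply/andP; split; lra.
Qed.

Lemma clamp_itv z : 0 <= clamp z <= 1.
Proof. by rewrite /clamp ge_min lexx le_min ler01 le_max lexx. Qed.

Lemma clamp_neq0 z : clamp z != 0 -> 0 < z.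
Proof.
rewrite ltNge; apply: contra => z0; rewrite /clamp (max_idPl z0).
by rewrite (min_idPr _) // ler01.
Qed.

Lemma clamp_ge1 z : 1 <= z -> clamp z = 1.
Proof.
by move=> z1; rewrite /clamp; apply/min_idPl; rewrite le_max z1 orbT.
Qed.

Definition dist_int (z : R) := Num.min (z - (Num.floor z)%:~R) ((Num.floor z + 1)%:~R - z).

Lemma dist_int_le z (k : int) : dist_int z <= `|z - k%:~R|.
Proof.
rewrite /dist_int; have h1 := floor_le z; have h2 := floorD1_gt z.
have [kz|kz] := lerP k (Num.floor z).
  have : k%:~R <= (Num.floor z)%:~R :> R by rewrite ler_int.
  move=> h3; rewrite ge_min ger0_norm; first by rewrite lerD2l lerN2 h3.
  by lra.
have : (Num.floor z + 1)%:~R <= k%:~R :> R by rewrite ler_int lezD1.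
move=> h3; rewrite ge_min distrC [X in _ || (_ <= X)]ger0_norm.
  by rewrite lerD2r h3 orbT.
by lra.
Qed.

Lemma dist_int_attained z : exists k : int, dist_int z = `|z - k%:~R|.
Proof.
rewrite /dist_int; have h1 := floor_le z; have h2 := floorD1_gt z.
rewrite minEle; case: ifP => _; first by exists (Num.floor z); rewrite ger0_norm ?subr_ge0.
by exists (Num.floor z + 1); rewrite distrC ger0_norm ?subr_ge0 // ltW.
Qed.

Lemma dist_int_continuous : continuous dist_int.
Proof.
apply: lipschitz1_continuous => a b.
have key x y : dist_int x <= dist_int y + `|x - y|.
  have [k ->] := dist_int_attained y; apply: le_trans (dist_int_le x k) _.
  by have := ler_normD (x - y) (y - k%:~R); rewrite addrA subrK; lra.
by rewrite ler_norml; have := key a b; have := key b a; rewrite distrC; lra.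
Qed.

(** The integer part is locally constant away from the integers. *)
Lemma near_floor (z : R) : 0 < dist_int z ->
  \forall w \near z, Num.floor w = Num.floor z.
Proof.
rewrite /dist_int lt_min !subr_gt0 => /andP[h1 h2]; near=> w.
apply/eqP; rewrite floor_eq; apply/andP; split.
  by apply: ltW; near: w; exact: lt_nbhsr.
by near: w; exact: lt_nbhsl.
Unshelve. all: by end_near. Qed.

End realfun.

(** * Coordinates on the base *)

Lemma seq_minorant (R : realType) (T : eqType) (s : seq T) (r : T -> R) :
  (forall y, 0 < r y) -> exists2 d : R, 0 < d & forall y, y \in s -> d <= r y.
Proof.
move=> r0; elim: s => [|a s [d d0 hd]]; first by exists 1.
exists (Num.min d (r a)); first by rewrite lt_min d0 r0.
move=> y; rewrite inE ge_min => /orP[/eqP ->|/hd ->]; rewrite ?lexx ?orbT //.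
Qed.

Lemma fin_minorant (R : realType) (T : finType) (r : T -> R) :
  (forall y, 0 < r y) -> exists2 d : R, 0 < d & forall y, d <= r y.
Proof.
move=> r0; have [d d0 hd] := @seq_minorant R T (enum T) r r0.
by exists d => // y; apply: hd; rewrite mem_enum.
Qed.

Section sums.
Variables (R : realType) (T : topologicalType).

Lemma ctsD (h k : T -> R) : continuous h -> continuous k -> continuous (fun x => h x + k x).
Proof. by move=> ch ck x; exact: (continuousD (ch x) (ck x)). Qed.

Lemma ctsB (h k : T -> R) : continuous h -> continuous k -> continuous (fun x => h x - k x).
Proof. by move=> ch ck x; exact: (continuousB (ch x) (ck x)). Qed.

Lemma ctsM (h k : T -> R) : continuous h -> continuous k -> continuous (fun x => h x * k x).
Proof. by move=> ch ck x; exact: (continuousM (ch x) (ck x)). Qed.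

Lemma cts_comp (S : topologicalType) (h : T -> S) (k : S -> R) :
  continuous h -> continuous k -> continuous (fun x => k (h x)).
Proof. by move=> ch ck x; apply: (@continuous_comp _ _ _ h k); [exact: ch | exact: ck]. Qed.

Lemma cts_norm (h : T -> R) : continuous h -> continuous (fun x => `|h x|).
Proof. by move=> ch; apply: cts_comp => // x; exact: norm_continuous. Qed.

Lemma cts_cst (a : R) : continuous (fun _ : T => a).
Proof. exact: cst_continuous. Qed.

Lemma continuous_sumf (I : Type) (r : seq I) (P : pred I) (h : I -> T -> R) :
  (forall i, continuous (h i)) -> continuous (fun x => \sum_(i <- r | P i) h i x).
Proof.
move=> ch; elim: r => [|a r IH].
  have -> : (fun x => \sum_(i <- [::] | P i) h i x) = (fun=> 0).
    by apply/funext => x; rewrite big_nil.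
  exact: cst_continuous.
have [Pa|Pa] := boolP (P a).
  have -> : (fun x => \sum_(i <- a :: r | P i) h i x) = (fun x => h a x + \sum_(i <- r | P i) h i x).
    by apply/funext => x; rewrite big_cons Pa.
  exact: ctsD.
have -> : (fun x => \sum_(i <- a :: r | P i) h i x) = (fun x => \sum_(i <- r | P i) h i x).
  by apply/funext => x; rewrite big_cons (negbTE Pa).
exact: IH.
Qed.

Lemma continuous_prodf (I : Type) (r : seq I) (h : I -> T -> R) :
  (forall i, continuous (h i)) -> continuous (fun x => \prod_(i <- r) h i x).
Proof.
move=> ch; elim: r => [|a r IH].
  have -> : (fun x => \prod_(i <- [::]) h i x) = (fun=> 1).
    by apply/funext => x; rewrite big_nil.
  exact: cst_continuous.
have -> : (fun x => \prod_(i <- a :: r) h i x) = (fun x => h a x * \prod_(i <- r) h i x).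
  by apply/funext => x; rewrite big_cons.
exact: ctsM.
Qed.

(** Multiplying by a continuous function that vanishes wherever [tau] jumps
restores continuity. *)
Lemma continuous_locally_constant (b tau : T -> R) (C : R) :
  continuous b -> (forall x, `|tau x| <= C) ->
  (forall x, b x != 0 -> \forall y \near x, tau y = tau x) ->
  continuous (fun x => tau x * b x).
Proof.
move=> cb ht lc x; have [bx|bx] := eqVneq (b x) 0.
  apply/cvgrPdist_lt => e e0; rewrite bx mulr0.
  have C0 : 0 <= C by apply: le_trans (ht x).
  have C1 : 0 < C + 1 by rewrite ltr_wpDl.
  have := cb x; move=> /cvgrPdist_lt/(_ (e / (C + 1)) (divr_gt0 e0 C1)).
  apply: filterS => y; rewrite bx !sub0r !normrN normrM => hb.
  rewrite ltr_pdivlMr // in hb.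
  apply: le_lt_trans hb; rewrite mulrC; apply: ler_wpM2l => //.
  by apply: le_trans (ht y) _; rewrite lerDl.
have h : {near x, (fun y => tau x * b y) =1 (fun y => tau y * b y)}.
  by have := lc x bx; apply: filterS => y ->.
have : {for x, continuous (fun y => tau x * b y)}.
  by apply: (@continuousM _ _ (fun=> tau x)); [exact: cst_continuous | exact: cb].
by rewrite /continuous_at => hc; apply: cvg_trans hc; apply: near_eq_cvg.
Qed.

End sums.

Section coords.
Variables (R : realType) (K : topologicalType) (d : nat) (c : 'I_d -> K -> R).
Hypothesis cK : compact [set: K].
Hypothesis cts_c : forall j, continuous (c j).
Hypothesis basis : forall y U, nbhs y U -> exists2 r : R, 0 < r &
  forall x, (forall j, `|c j x - c j y| < r) -> U x.

(** The function is not truncated: it may be negative far from [y]. *)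
Lemma exists_bump y U : nbhs y U -> exists2 chi : K -> R, continuous chi &
  chi y = 1 /\ forall x, 0 < chi x -> U x.
Proof.
move=> /basis[r r0 hU].
exists (fun x => 1 - (\sum_j `|c j x - c j y|) / r).
  apply: ctsB; first exact: cts_cst.
  apply: ctsM; last exact: cts_cst.
  by apply: continuous_sumf => j; apply: cts_norm; apply: ctsB => //; exact: cts_cst.
split.
  by rewrite big1 ?mul0r ?subr0 // => j _; rewrite subrr normr0.
move=> x; rewrite subr_gt0 ltr_pdivrMr // mul1r => h; apply: hU => j.
by apply: le_lt_trans h; rewrite (bigD1 j) //= lerDl sumr_ge0.
Qed.

(** Uniform continuity with respect to the coordinates, which play the role of a
metric on K. *)
Lemma coords_unif (h : K -> R) (e : R) : continuous h -> 0 < e ->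
  exists2 r : R, 0 < r & forall x y, (forall j, `|c j x - c j y| < r) -> `|h x - h y| < e.
Proof.
move=> ch e0; have e2 : 0 < e / 2 by rewrite divr_gt0.
have hP y : exists r : R, 0 < r /\ forall x, (forall j, `|c j x - c j y| < r) -> `|h x - h y| < e / 2.
  have nU : nbhs y [set x | `|h x - h y| < e / 2].
    by have /cvgrPdist_lt/(_ _ e2) := ch y; apply: filterS => x /=; rewrite distrC.
  by have [r r0 hr] := basis nU; exists r.
have /choice[r hr] := hP.
have [|s hs] := @compact_fincover _ cK (fun y => [set x | forall j, `|c j x - c j y| < r y / 2]).
  move=> y; have [r0 _] := hr y.
  have r2 : 0 < r y / 2 by rewrite divr_gt0.
  apply: filter_forall => j.
  have cj : {for y, continuous (c j)} by exact: cts_c.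
  by move/cvgrPdist_lt: cj => /(_ _ r2); apply: filterS => x /=; rewrite distrC.
have [rho rho0 hrho] := @seq_minorant R K s (fun y => r y / 2) (fun y => divr_gt0 (hr y).1 (ltr0n _ 2)).
exists rho => // x x' xx'; have [y ys hy] := hs x.
have [_ hr2] := hr y.
have h1 : `|h x - h y| < e / 2.
  apply: hr2 => j; apply: lt_le_trans (hy j) _.
  by rewrite ler_pdivrMr // ler_peMr ?ltW ?(hr y).1 // ltr1n.
have h2 : `|h x' - h y| < e / 2.
  apply: hr2 => j; have := hy j; have := xx' j; have := hrho y ys.
  have := ler_normD (c j x' - c j x) (c j x - c j y); rewrite addrA subrK.
  rewrite [`|c j x' - c j x|]distrC; lra.
have := ler_normD (h x - h y) (h y - h x'); rewrite addrA subrK.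
rewrite [`|h y - h x'|]distrC; lra.
Qed.

End coords.

(** * Families of cubes with few bad indices *)

Lemma sum_exclusive (T : finType) (P : pred T) :
  (forall x y, P x -> P y -> x = y) -> (\sum_(x : T) (P x : nat) <= 1)%N.
Proof.
move=> h; case: (pickP P) => [x Px|P0]; last by rewrite big1 // => x _; rewrite P0.
rewrite (bigD1 x) //= big1 ?Px // => y yx; case: (boolP (P y)) => // Py.
by rewrite (h _ _ Py Px) eqxx in yx.
Qed.

Lemma dist_lt1 (R : realType) (a b z : R) :
  z <= a -> a < z + 1 -> z <= b -> b < z + 1 -> `|a - b| < 1.
Proof. by move=> *; rewrite ltr_norml; apply/andP; split; lra. Qed.

Section kolmogorov.
Variables (R : realType) (K : topologicalType) (d : nat) (c : 'I_d -> K -> R).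
Hypothesis cts_c : forall j, continuous (c j).

(** In the coordinates, the family [l] is made of the cubes of a grid of mesh
[rho] translated by l/m times the mesh in all directions, where m is the
number of families; [b l] equals one except near the faces of the grid,
where it decreases to zero, and [cell l] names the cube. For each
coordinate, a given point is close to the faces of at most one of the m
translated grids, so it is badly placed for at most one family per
coordinate. *)
Lemma kolmogorov_families (I : finType) (rho : R) : 0 < rho ->
  exists (b : I -> K -> R) (cell : I -> K -> {ffun 'I_d -> int}),
  [/\ forall l, continuous (b l),
      forall l x, 0 <= b l x <= 1,
      forall l x, b l x != 0 -> \forall y \near x, cell l y = cell l x,
      forall l x y, cell l x = cell l y -> forall j, `|c j x - c j y| < rho &
      forall x, (\sum_(l : I) (b l x < 1)%R <= d)%N].
Proof.
move=> rho0; set m := #|I|%:R : R.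
pose pos (l : I) x j := c j x / rho - (enum_rank l)%:R / m.
exists (fun l x => \prod_j clamp (2 * m * dist_int (pos l x j))).
exists (fun l x => [ffun j => Num.floor (pos l x j)]).
have cpos l j : continuous (fun x => pos l x j).
  by apply: ctsB; [apply: ctsM => //; exact: cts_cst | exact: cts_cst].
have m0 (l : I) : 0 < m.
  by rewrite ltr0n; apply/card_gt0P; exists l.
split.
- move=> l; apply: continuous_prodf => j.
  have h1 : continuous (fun x => dist_int (pos l x j)).
    exact: (cts_comp (cpos l j) (@dist_int_continuous R)).
  have h2 : continuous (fun x => 2 * m * dist_int (pos l x j)).
    by apply: ctsM => //; exact: cts_cst.
  exact: (cts_comp h2 (@clamp_continuous R)).
- move=> l x; apply/andP; split.
    by apply: prodr_ge0 => j _; case/andP: (clamp_itv (2 * m * dist_int (pos l x j))).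
  by apply: prodr_ile1 => j _; exact: clamp_itv.
- move=> l x; rewrite prodf_seq_neq0 => /allP bx.
  have near_j j : \forall y \near x, Num.floor (pos l y j) = Num.floor (pos l x j).
    have dz0 : 0 < dist_int (pos l x j).
      have /= := bx j (mem_index_enum _) => /clamp_neq0.
      by rewrite pmulr_rgt0 // mulr_gt0 // m0.
    exact: (cpos l j x _ (near_floor dz0)).
  have : \forall y \near x, forall j, Num.floor (pos l y j) = Num.floor (pos l x j).
    exact: filter_forall.
  apply: filterS => y hy.
  by apply/ffunP => j; rewrite !ffunE.
- move=> l x y /ffunP exy j; have := exy j; rewrite !ffunE => e.
  have h1 := floor_le (pos l x j); have h2 := floorD1_gt (pos l x j).
  have h3 := floor_le (pos l y j); have h4 := floorD1_gt (pos l y j).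
  rewrite -e in h3 h4; rewrite intrD in h2 h4.
  have : `|pos l x j - pos l y j| < 1 by exact: dist_lt1 h1 h2 h3 h4.
  have -> : pos l x j - pos l y j = (c j x - c j y) / rho by rewrite /pos; ring.
  by rewrite normf_div (gtr0_norm rho0) ltr_pdivrMr // mul1r.
move=> x; pose bad l j := 2 * m * dist_int (pos l x j) < 1.
apply: (@leq_trans (\sum_(l : I) \sum_(j : 'I_d) (bad l j : nat))).
  apply: leq_sum => l _; case: (boolP (_ < 1)) => //= hb.
  have [j hj] : exists j, bad l j.
    apply/existsP; apply: contraLR hb; rewrite negb_exists => /forallP h.
    rewrite -leNgt big1 // => j _; apply: clamp_ge1.
    by have := h j; rewrite /bad -leNgt.
  by rewrite (bigD1 j) //= hj.
rewrite exchange_big /= -[leqRHS]card_ord -sum1_card.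
apply: leq_sum => j _; apply: sum_exclusive => l l' hl hl'.
have ml := m0 l; have m2 : 0 < 2 * m by rewrite mulr_gt0.
have [k hk] := dist_int_attained (pos l x j); have [k' hk'] := dist_int_attained (pos l' x j).
move: hl hl'; rewrite /bad hk hk' => h h'.
have hd : `|(pos l x j - k%:~R) - (pos l' x j - k'%:~R)| * m < 1.
  apply: (@le_lt_trans _ _ ((`|pos l x j - k%:~R| + `|pos l' x j - k'%:~R|) * m)).
    by apply: ler_wpM2r; [exact: ltW | exact: ler_normB].
  move: h h'; set a := `|pos l x j - _|; set b := `|pos l' x j - _|.
  by move: a b (m); clear => a b n; lra.
have e : ((pos l x j - k%:~R) - (pos l' x j - k'%:~R)) * m =
   (Posz (enum_rank l') - Posz (enum_rank l) + (k' - k) * #|I|)%:~R.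
  rewrite !(intrD, intrM, intrB) /pos /= -!pmulrn -/m; field.
  by rewrite !gt_eqF.
have : `|Posz (enum_rank l') - Posz (enum_rank l) + (k' - k) * (Posz #|I|) | < 1.
  by rewrite -(@ltr_int R) intr_norm -e normrM [`|m|]gtr0_norm.
have hl := ltn_ord (enum_rank l); have hl' := ltn_ord (enum_rank l').
move=> h0; apply: enum_rank_inj; apply: val_inj => /=.
move: h0 hl hl'; clear.
set u := nat_of_ord _; set v := nat_of_ord _; set n := #|I|.
move: u v n => u v n h hu hv.
move: (k' - k) h => q; rewrite ltr_norml => /andP[h1 h2].
have {h1 h2} h : (Posz u - Posz v + q * Posz n = 0)%R.
  by move: (q * Posz n) h1 h2 => w; lia.
have q1 : (q <= 0)%R by rewrite leNgt; apply/negP => q1; nia.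
have q2 : (0 <= q)%R by rewrite leNgt; apply/negP => q2; nia.
have q0 : q = 0 by lia.
by move: h; rewrite q0; lia.
Qed.

End kolmogorov.

(** * General position of level sets *)

Section general_position.
Variables (R : realType) (K : topologicalType) (f : homeo K K) (d : nat)
  (c : 'I_d -> K -> R).
Hypothesis cK : compact [set: K].
Hypothesis cts_c : forall j, continuous (c j).
Hypothesis basis : forall y U, nbhs y U -> exists2 r : R, 0 < r &
  forall x, (forall j, `|c j x - c j y| < r) -> U x.
Variables (p M : nat).
Implicit Types (chi : 'I_p -> K -> R) (beta : K -> R).

(** The number of pairs (function, time) for which the orbit of [y] is close to
the level 1/2 within the first [M] times. *)
Definition crossings chi (e : R) y :=
  (\sum_(i < M) \sum_(s < p) (`|chi s (iter i f y) - 2^-1| < e)%R)%N.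

(** The first [M] images of the set where [beta] does not vanish are pairwise
disjoint, so that a function can be modified independently on each of them. *)
Definition tower beta := [/\ continuous beta, forall x, 0 <= beta x <= 1 &
  forall (i i' : 'I_M) y y', beta y != 0 -> beta y' != 0 ->
    iter i f y = iter i' f y' -> i = i'].

(** The values of the functions chi_s along the orbit of a point y of the tower
are modified as functions of y: the pair (s, i) is given its own family of
cubes, and on each cube chi_s o f^i is pushed away from the level 1/2 by
[e], upwards if it reaches the level in the cube and downwards otherwise. At
a point well placed in the cube the level is avoided by at least e / 2, and
there are at most [d] pairs for which the point is badly placed. *)
Lemma general_position_step chi beta (e : R) :
  0 < e -> (forall s, continuous (chi s)) -> tower beta ->
  exists chi', [/\ forall s, continuous (chi' s),
    forall s x, `|chi' s x - chi s x| <= e &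
    forall y, beta y = 1 -> (crossings chi' (e / 2) y <= d)%N].
Proof.
move=> e0 cchi [cb b01 disj].
(* Cubes are so small that the functions oscillate by less than e / 4 on them, less than the push by e. *)
have e4 : 0 < e / 4 by rewrite divr_gt0.
have citer i : continuous (iter i f) by apply: iter_continuous; exact: homeo_continuous.
have /choice[r hr] : forall l : 'I_p * 'I_M, exists r : R, 0 < r /\
    forall x y, (forall j, `|c j x - c j y| < r) ->
      `|chi l.1 (iter l.2 f x) - chi l.1 (iter l.2 f y)| < e / 4.
  move=> l; have [r r0 h] := coords_unif cK cts_c basis
     (cts_comp (citer l.2) (cchi l.1)) e4.
  by exists r.
have [rho rho0 hrho] := fin_minorant (fun l => (hr l).1).
have [b [cell [cb' b01' lc small mult]]] :=
  kolmogorov_families cts_c ('I_p * 'I_M)%type rho0.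
pose up (l : 'I_p * 'I_M) (q : {ffun 'I_d -> int}) :=
  `[< exists y, cell l y = q /\ 2^-1 <= chi l.1 (iter l.2 f y) >].
pose sg l x : R := if up l (cell l x) then e else - e.
pose u l x := sg l x * (b l x * beta x).
have cu l : continuous (u l).
  apply: (@continuous_locally_constant _ _ _ _ e).
  - exact: ctsM.
  - by move=> x; rewrite /sg; case: ifP; rewrite ?normrN gtr0_norm.
  - move=> x; rewrite mulf_eq0 negb_or => /andP[bx _].
    by have := lc l x bx; apply: filterS => y; rewrite /sg => ->.
have ub l x : `|u l x| <= e.
  rewrite /u !normrM -[leRHS]mulr1 ler_pM //.
    by rewrite /sg; case: ifP; rewrite ?normrN gtr0_norm.
  have /andP[h1 h2] := b01' l x; have /andP[h3 h4] := b01 x.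
  by rewrite !ger0_norm // mulr_ile1.
have ubeta l x : beta x = 0 -> u l x = 0 by rewrite /u => ->; rewrite !mulr0.
pose inv i := iter i (homeo_inv f).
exists (fun s z => chi s z + \sum_(i < M) u (s, i) (inv i z)).
split.
- move=> s; apply: ctsD => //; apply: continuous_sumf => i.
  apply: cts_comp => //; apply: iter_continuous; exact: homeo_inv_continuous.
- move=> s x; rewrite addrAC subrr add0r.
  have [[i hi]|none] := pselect (exists i : 'I_M, beta (inv i x) != 0); last first.
    rewrite big1 ?normr0 ?ltW // => i _; apply: ubeta.
    by apply/eqP; apply: contrapT => /negP h; apply: none; exists i.
  rewrite (bigD1 i) //= big1 ?addr0 // => i' ii'; apply: ubeta; apply/eqP.
  apply: contraNT ii' => hi'; apply/eqP; apply: (disj _ _ _ _ hi' hi).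
  by rewrite /inv !homeo_iter_invK.
- move=> y by1.
  have by0 : beta y != 0 by rewrite by1 oner_eq0.
  apply: leq_trans (mult y).
  have -> : (\sum_(l : 'I_p * 'I_M) (b l y < 1)%R = \sum_s \sum_i (b (s, i) y < 1)%R)%N.
    by rewrite pair_bigA; apply: eq_bigr => -[].
  rewrite exchange_big /=.
  rewrite /crossings; apply: leq_sum => i _; apply: leq_sum => s _.
  rewrite (bigD1 i) //= {1}/inv homeo_iterK big1 ?addr0; last first.
    move=> i' ii'; apply: ubeta; apply/eqP; apply: contraNT ii' => hi'.
    by apply/eqP; apply: (disj _ _ _ _ hi' by0); rewrite /inv homeo_iter_invK.
  have /andP[_ h2] := b01' (s, i) y.
  case: (ltrP (b (s, i) y) 1) => [_|h1]; first by case: (_ < _).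
  have b1 : b (s, i) y = 1 by apply/eqP; rewrite eq_le h1 h2.
  rewrite leqn0 eqb0 -leNgt /u b1 by1 !mulr1 /sg; case: ifPn.
    move=> /asboolP[y' [ec hy']].
    have : `|chi s (iter i f y') - chi s (iter i f y)| < e / 4.
      apply: (hr (s, i)).2 => j; apply: lt_le_trans (hrho (s, i)).
      exact: (small (s, i)).
    rewrite ltr_norml => /andP[h3 h4].
    rewrite ger0_norm; lra.
  move=> /asboolPn hn.
  have h3 : chi s (iter i f y) < 2^-1.
    by rewrite ltNge; apply/negP => h3; apply: hn; exists y.
  rewrite ler0_norm; lra.
Qed.

Lemma crossings_mono chi chi' (e e' : R) y :
  (forall s x, `|chi' s x - chi s x| <= e - e') ->
  (crossings chi' e' y <= crossings chi e y)%N.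
Proof.
move=> h; apply: leq_sum => i _; apply: leq_sum => s _.
case: (ltrP `|chi' s _ - _| e') => //= h1; rewrite lt0b.
have := h s (iter i f y).
have := ler_normD (chi s (iter i f y) - chi' s (iter i f y)) (chi' s (iter i f y) - 2^-1).
rewrite addrA subrK [`|chi s _ - chi' s _|]distrC; move: h1; clear; lra.
Qed.

(** The towers are treated one after the other; each correction is small with
respect to the margin [delta] obtained for the previous ones. *)
Lemma general_position chi (bs : seq (K -> R)) (e : R) :
  0 < e -> (forall s, continuous (chi s)) ->
  (forall beta, List.In beta bs -> tower beta) ->
  exists chi', [/\ forall s, continuous (chi' s),
    forall s x, `|chi' s x - chi s x| <= e &
    exists2 delta : R, 0 < delta & forall beta y, List.In beta bs ->
      beta y = 1 -> (crossings chi' delta y <= d)%N].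
Proof.
move=> + cchi; elim: bs e => [|beta bs IH] e e0 hbs.
  exists chi; split => // [s x|]; first by rewrite subrr normr0 ltW.
  by exists 1.
have [|chi1 [c1 h1 [d1 d10 hd1]]] := IH _ (divr_gt0 e0 (ltr0n _ 2)).
  by move=> b hb; apply: hbs; right.
(* The second bound keeps half of the margin obtained for the previous towers. *)
pose e2 := Num.min (e / 2) (d1 / 2).
have e20 : 0 < e2 by rewrite lt_min !divr_gt0.
have e2e : e2 <= e / 2 by rewrite ge_min lexx.
have e2d : e2 <= d1 / 2 by rewrite ge_min lexx orbT.
have [chi2 [c2 h2 hb2]] := general_position_step e20 c1 (hbs beta (or_introl erefl)).
exists chi2; split => //.
  move=> s x; have := h1 s x; have := h2 s x.
  have := ler_normD (chi2 s x - chi1 s x) (chi1 s x - chi s x); rewrite addrA subrK.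
  by move: e2e; clear; lra.
exists (e2 / 2); first by rewrite divr_gt0.
move=> b y [<-|hb] by1; first exact: hb2.
apply: leq_trans (hd1 b y hb by1); apply: crossings_mono => s x.
apply: le_trans (h2 s x) _; move: (e2) e20 e2d => z z0 zd; lra.
Qed.

End general_position.

(** * Towers and markers *)

Section markers.
Variables (R : realType) (K : topologicalType) (f : homeo K K) (d : nat)
  (c : 'I_d -> K -> R).
Hypothesis cK : compact [set: K].
Hypothesis mf : minimal f.
Hypothesis cts_c : forall j, continuous (c j).
Hypothesis basis : forall y U, nbhs y U -> exists2 r : R, 0 < r &
  forall x, (forall j, `|c j x - c j y| < r) -> U x.
Hypothesis sep : forall x y, (forall j, c j x = c j y) -> x = y.
Hypothesis aper : forall x i, (0 < i)%N -> iter i f x <> x.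

Lemma homeo_iter_inj i : injective (iter i f).
Proof. exact: can_inj (homeo_iterK f i). Qed.

Lemma iter_neq y i i' : i != i' -> iter i f y <> iter i' f y.
Proof.
wlog ii' : i i' / (i < i')%N.
  move=> H; case: (ltngtP i i') => // h _ e; first by apply: (H _ _ h) e; rewrite ltn_eqF.
  by apply: (H _ _ h) (esym e); rewrite ltn_eqF.
move=> _; rewrite -(subnKC (ltnW ii')) iterD => /homeo_iter_inj e.
by apply: (aper (i := i' - i) (x := y)); rewrite ?subn_gt0.
Qed.

(** Without periodic points the images of [y] are distinct, hence separated by
some coordinate. *)
Lemma disjoint_nbhs (M : nat) (y : K) : exists2 U : set K, nbhs y U &
  forall (i i' : 'I_M) x x', U x -> U x' -> iter i f x = iter i' f x' -> i = i'.
Proof.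
have citer i : continuous (iter i f) by apply: iter_continuous; exact: homeo_continuous.
have /choice[U hU] : forall l : 'I_M * 'I_M, exists U : set K, nbhs y U /\
    (l.1 != l.2 -> forall x x', U x -> U x' -> iter l.1 f x <> iter l.2 f x').
  move=> [i i'] /=; have [->|ii'] := eqVneq i i'; first by exists setT; split; [exact: filterT|].
  have [j hj] : exists j, c j (iter i f y) <> c j (iter i' f y).
    apply: contrapT => /forallNP h; apply: (@iter_neq y i i') => //.
    by apply: sep => j; apply: contrapT; exact: h.
  have r0 : 0 < `|c j (iter i f y) - c j (iter i' f y)| / 2.
    by rewrite divr_gt0 // normr_gt0 subr_eq0; exact/eqP.
  set r := _ / 2 in r0.
  have cj k : continuous (fun x => c j (iter k f x)) by exact: (cts_comp (citer k) (@cts_c j)).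
  exists [set x | `|c j (iter i f y) - c j (iter i f x)| < r /\
            `|c j (iter i' f y) - c j (iter i' f x)| < r]; split.
    have h1 : {for y, continuous (fun x => c j (iter i f x))} by exact: cj.
    have h2 : {for y, continuous (fun x => c j (iter i' f x))} by exact: cj.
    move/cvgrPdist_lt: h1 => /(_ _ r0) h1; move/cvgrPdist_lt: h2 => /(_ _ r0) h2.
    exact: filterI h1 h2.
  move=> _ x x' [h1 _] [_ h2] e.
  have := ler_normD (c j (iter i f y) - c j (iter i f x)) (c j (iter i f x) - c j (iter i' f y)).
  rewrite addrA subrK e [`|c j (iter i' f x') - _|]distrC -e.
  have e2 : `|c j (iter i f y) - c j (iter i' f y)| = r + r by rewrite /r -splitr.
  by move: h1 h2; rewrite e2 e; lra.
exists [set x | forall l, U l x].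
  by apply: filter_forall => l; exact: (hU l).1.
move=> i i' x x' hx hx' e; apply/eqP; apply/negPn/negP => ii'.
by apply: (hU (i, i')).2 (hx _) (hx' _) e.
Qed.

Lemma exists_tower (M : nat) (y : K) : exists2 beta : K -> R, tower f M beta &
  \forall x \near y, beta x = 1.
Proof.
have [U nU hU] := disjoint_nbhs M y.
have [chi cchi [chi1 chiU]] := exists_bump cts_c basis nU.
have c2 : continuous (fun x => 2 * chi x) by apply: ctsM => //; exact: cts_cst.
exists (fun x => clamp (2 * chi x)).
  split; first exact: (cts_comp c2 (@clamp_continuous R)).
    by move=> x; exact: clamp_itv.
  move=> i i' x x' /clamp_neq0 hx /clamp_neq0 hx' e.
  by apply: hU e; apply: chiU; lra.
have h : 2^-1 < chi y by rewrite chi1; lra.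
have := nbhs_gt cchi h; apply: filterS => x /= hx; apply: clamp_ge1; lra.
Qed.

Lemma tower_cover (M : nat) : exists2 bs : seq (K -> R),
  (forall beta, List.In beta bs -> tower f M beta) &
  forall x, exists2 beta, List.In beta bs & beta x = 1.
Proof.
have /choice[b hb] : forall y : K, exists beta : K -> R, tower f M beta /\
    (\forall x \near y, beta x = 1).
  by move=> y; have [b] := exists_tower M y; exists b.
have [s hs] := compact_fincover cK (fun y => (hb y).2).
exists (map b s).
  elim: s {hs} => //= y s IH beta [<-|/IH//]; exact: (hb y).1.
move=> x; have [y ys h] := hs x; exists (b y) => //.
elim: s ys {hs} => //= a s IH; rewrite inE => /orP[/eqP ->|/IH]; by [left|right].
Qed.

(** A bump function with support in a set whose first [n] images are disjoint:
returns take at least [n] steps by disjointness, and at most [N] by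
minimality. *)
Lemma exists_marker (n : nat) : (exists x : K, True) -> exists2 chi : K -> R, continuous chi &
  (forall x i, (0 < i < n)%N -> 0 < chi x -> chi (iter i f x) <= 0) /\
  exists N, forall x, exists2 k, (k < N)%N & 3/4 < chi (iter k f x).
Proof.
move=> [y _]; have [U nU hU] := disjoint_nbhs n y.
have [chi cchi [chi1 chiU]] := exists_bump cts_c basis nU.
exists chi => //; split.
  move=> x i /andP[i0 iN] hx; rewrite leNgt; apply/negP => hi.
  have n0 : (0 < n)%N by apply: leq_trans iN.
  have := hU (Ordinal iN) (Ordinal n0) x (iter i f x) (chiU _ hx) (chiU _ hi) erefl.
  by move=> /(congr1 val) /= e; rewrite e in i0.
apply: (@syndetic _ f [set x | 3/4 < chi x]) => //.
  by rewrite openE => x hx; exact: nbhs_gt.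
by exists y; rewrite /= chi1; lra.
Qed.

End markers.

(** * A perturbation read off from itineraries *)

Lemma find_iotaP (P : pred nat) m j : (j < m)%N -> P j ->
  (forall i, (i < j)%N -> ~~ P i) -> find P (iota 0 m) = j.
Proof.
move=> jm Pj nP; have -> : m = (j + (m - j))%N by rewrite subnKC // ltnW.
rewrite iotaD find_cat size_iota add0n; have -> : has P (iota 0 j) = false.
  by apply/negP => /hasP[i]; rewrite mem_iota add0n => /nP /negbTE ->.
have [k ->] : exists k, (m - j = k.+1)%N by exists (m - j).-1; rewrite prednK // subn_gt0.
by rewrite /= Pj addn0.
Qed.

Section blocks.
Variables (R : realType) (K : topologicalType) (f : homeo K K).
Variables (g : K -> 'M[R]_2) (p N n : nat) (chi : 'I_p.+1 -> K -> R).
Variables (prog : 'I_p -> nat -> nat -> R) (eta C0 delta : R).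
Hypothesis delta_gt0 : 0 < delta.
Hypothesis cchi : forall s, continuous (chi s).
Definition above s x := 2^-1 < chi s x.
Hypothesis ret_ge : forall x i, (0 < i < n)%N -> above ord0 x -> ~~ above ord0 (iter i f x).
Hypothesis visit : forall x, exists2 k, (k < N)%N & above ord0 (iter k f x).
Hypothesis select : forall x, exists s : 'I_p, above (lift ord0 s) x.
Hypothesis eta_ge0 : 0 <= eta.
Hypothesis prog_le : forall s r j, `|prog s r j| <= eta.
Hypothesis prog_ok : forall (s : 'I_p) x r, (r <= N)%N -> above (lift ord0 s) x ->
  l1norm (mprod (perturb (prog s r) (orbmx f g x)) r) <= C0.

(** Itineraries are read from time -N on, so that all times in the window are
natural numbers. *)
Definition back x := iter N (homeo_inv f) x.

Local Notation I := ('I_(2 * N).+1 * 'I_p.+1)%type.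

Definition itinerary x : {ffun I -> bool} := [ffun l : I => above l.2 (iter l.1 f (back x))].

(** In a window centred at the current point, [lag] is the time elapsed since
the last marker and [r] the length of the current block. The program is
selected by the first available function at the beginning of the block. *)
Definition decode (w : {ffun I -> bool}) : R :=
  let cw i s := w (inord i, s) in
  let lag := find (fun j => cw (N - j)%N ord0) (iota 0 N) in
  let r := (find (fun i => cw (N - lag + i.+1)%N ord0) (iota 0 N)).+1 in
  if [pick s : 'I_p | cw (N - lag)%N (lift ord0 s)] is Some s then prog s r lag
  else 0.

(** Vanishes when some symbol of the itinerary is about to change, and equals
one when all of them are determined with margin [delta]. *)
Definition safety x : R := \prod_(l : I) clamp (`|chi l.2 (iter l.1 f (back x)) - 2^-1| / delta).

Definition control x : R := decode (itinerary x) * safety x.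

Lemma decode_le w : `|decode w| <= eta.
Proof. by rewrite /decode /=; case: pickP => [s|] _; rewrite ?normr0. Qed.

Let cback i : continuous (fun x => iter i f (back x)).
Proof.
move=> x; apply: (@continuous_comp _ _ _ back (iter i f)).
  by apply: iter_continuous; exact: homeo_inv_continuous.
by apply: iter_continuous; exact: homeo_continuous.
Qed.

Let cval (l : I) : continuous (fun x => chi l.2 (iter l.1 f (back x))).
Proof. exact: (cts_comp (@cback l.1) (@cchi l.2)). Qed.

Lemma safety_itv x : 0 <= safety x <= 1.
Proof.
apply/andP; split.
  by apply: prodr_ge0 => l _; case/andP: (clamp_itv (`|chi l.2 (iter l.1 f (back x)) - 2^-1| / delta)).
by apply: prodr_ile1 => l _; exact: clamp_itv.
Qed.

Lemma control_le x : `|control x| <= eta.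
Proof.
have /andP[h1 h2] := safety_itv x.
by rewrite /control normrM (ger0_norm h1) -[leRHS]mulr1 ler_pM // decode_le.
Qed.

(** The itinerary is locally constant where [safety] does not vanish. *)
Lemma control_continuous : continuous control.
Proof.
apply: (@continuous_locally_constant _ _ safety (fun x => decode (itinerary x)) eta).
- apply: continuous_prodf => l.
  have h1 : continuous (fun x => `|chi l.2 (iter l.1 f (back x)) - 2^-1| / delta).
    apply: ctsM; last exact: cts_cst.
    by apply: cts_norm; apply: ctsB; [exact: cval | exact: cts_cst].
  exact: (cts_comp h1 (@clamp_continuous R)).
- by move=> x; exact: decode_le.
- move=> x; rewrite /safety prodf_seq_neq0 => /allP sx.
  have near_l l : \forall y \near x, itinerary y l = itinerary x l.
    have /= := sx l (mem_index_enum _) => /clamp_neq0.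
    rewrite pmulr_lgt0 ?invr_gt0 // normr_gt0 subr_eq0 => hl.
    rewrite /itinerary ffunE /above.
    case: (ltrgtP (2^-1) (chi l.2 (iter l.1 f (back x)))) hl => // h _.
      have := nbhs_gt (@cval l) h; apply: filterS => y /= hy; rewrite !ffunE.
      by rewrite /above hy.
    have := nbhs_lt (@cval l) h; apply: filterS => y /= hy; rewrite !ffunE.
    by rewrite /above ltNge (ltW hy).
  have : \forall y \near x, forall l, itinerary y l = itinerary x l by exact: filter_forall.
  by apply: filterS => y hy; congr decode; apply/ffunP.
Qed.

Definition near_threshold (x : K) := [exists s, `|chi s x - 2^-1| < delta].

Lemma safety1 x : (forall i, (i <= 2 * N)%N -> ~~ near_threshold (iter i f (back x))) -> safety x = 1.
Proof.
move=> h; apply: big1 => -[i s] _ /=; apply: clamp_ge1.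
have := h i; rewrite -ltnS ltn_ord => /(_ isT); rewrite negb_exists => /forallP /(_ s).
by rewrite -leNgt ler_pdivlMr // mul1r.
Qed.

Definition return_time x := (find (fun i => above ord0 (iter i.+1 f x)) (iota 0 N)).+1.

Lemma return_timeP x : above ord0 x -> [/\ (n <= return_time x)%N, (return_time x <= N)%N,
   above ord0 (iter (return_time x) f x) &
   forall i, (0 < i < return_time x)%N -> ~~ above ord0 (iter i f x)].
Proof.
move=> hx; have [k kN hk] := visit (f x).
have hs : has (fun i => above ord0 (iter i.+1 f x)) (iota 0 N).
  by apply/hasP; exists k; rewrite ?mem_iota // iterSr.
have h1 : (return_time x <= N)%N by move: hs; rewrite has_find size_iota.
have h2 : above ord0 (iter (return_time x) f x).
  by have := nth_find 0%N hs; rewrite nth_iota ?add0n.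
split => //.
  rewrite leqNgt; apply/negP => h; move: h2; apply/negP; exact: ret_ge.
case=> // i /andP[_ ilt]; rewrite ltnS in ilt.
have := before_find 0%N ilt; rewrite nth_iota ?add0n => [->//|].
by apply: leq_trans ilt _; rewrite ltnW.
Qed.

(** Within a block, every point finds the same beginning and the same end of the
block in its window, hence plays the same program, each at its own time. *)
Lemma decode_block x : above ord0 x ->
  exists2 s : 'I_p, above (lift ord0 s) x &
  forall j, (j < return_time x)%N -> decode (itinerary (iter j f x)) = prog s (return_time x) j.
Proof.
move=> hx; have [nr rN hr before] := return_timeP hx.
pose s0 := [pick s : 'I_p | above (lift ord0 s) x].
case: (pickP (fun s : 'I_p => above (lift ord0 s) x)) => [s hs|]; last first.
  by have [s hs] := select x; move=> /(_ s); rewrite hs.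
exists (odflt s s0); first by rewrite /s0; case: pickP => // /(_ s); rewrite hs.
move=> j jr.
have jN : (j <= N)%N by apply: leq_trans rN; exact: ltnW.
have backE a : iter (N - j + a) f (back (iter j f x)) = iter a f x.
  have -> : back (iter j f x) = iter (N - j) (homeo_inv f) x.
    by rewrite /back -{1}(subnK jN) iterD homeo_iterK.
  by rewrite addnC iterD homeo_iter_invK.
have wE i s' a : i = (N - j + a)%N -> (a <= N)%N ->
    itinerary (iter j f x) (inord i, s') = above s' (iter a f x).
  move=> -> aN; rewrite ffunE /= inordK; first by rewrite backE.
  clear -jN aN; lia.
rewrite /decode /=.
have lagE : find (fun j0 => itinerary (iter j f x) (inord (N - j0), ord0)) (iota 0 N) = j.
  apply: find_iotaP.
  - exact: leq_trans rN.
  - by rewrite (wE _ _ 0%N) ?addn0.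
  - move=> i ij; rewrite (wE _ _ (j - i)%N); last 2 first.
    + clear -ij jN; lia.
    + by apply: leq_trans jN; exact: leq_subr.
    apply: before; rewrite subn_gt0 ij /=.
    by apply: leq_ltn_trans jr; exact: leq_subr.
rewrite lagE.
have -> : find (fun i => itinerary (iter j f x) (inord (N - j + i.+1), ord0)) (iota 0 N) = (return_time x).-1.
  apply: find_iotaP.
  - by rewrite prednK.
  - by rewrite (wE _ _ (return_time x)) // prednK.
  - move=> i; rewrite -ltnS prednK // => ilt.
    rewrite (wE _ _ i.+1) //; last by apply: leq_trans rN; exact: ltnW.
    by apply: before.
rewrite prednK //.
have -> : [pick s1 | itinerary (iter j f x) (inord (N - j), lift ord0 s1)] = s0.
  by apply: eq_pick => s1; rewrite (wE _ _ 0%N) ?addn0.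
rewrite /s0; case: pickP => [s1 _ //|/(_ s)]; by rewrite hs.
Qed.

(** The times involved are all those seen by a point of the block that starts at
[x]. *)
Definition unsafe x := [exists a : 'I_(3 * N).+1, near_threshold (iter a f (back x))].

Definition controlled x := cayley (control x) *m g x.

(** On a safe block the control coincides with the program that keeps the
product bounded. *)
Lemma good_block x : above ord0 x -> ~~ unsafe x ->
  l1norm (mprod (orbmx f controlled x) (return_time x)) <= C0.
Proof.
move=> hx nb; have [nr rN hr before] := return_timeP hx.
have [s hs hd] := decode_block hx.
have -> : mprod (orbmx f controlled x) (return_time x) =
    mprod (perturb (prog s (return_time x)) (orbmx f g x)) (return_time x); last exact: prog_ok.
apply: eq_mprod => j jr; rewrite /orbmx /controlled /perturb; congr (cayley _ *m _).
rewrite /control hd // safety1 ?mulr1 // => i iN.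
have jN : (j <= N)%N by apply: leq_trans rN; exact: ltnW.
have e : iter i f (back (iter j f x)) = iter (i + j) f (back x).
  rewrite iterD /back; congr (iter i f _).
  have -> : iter j f x = iter j f (iter N f (iter N (homeo_inv f) x)) by rewrite homeo_iter_invK.
  by rewrite -iterD addnC iterD homeo_iterK.
move: nb; rewrite negb_exists e => /forallP h.
have l : (i + j < (3 * N).+1)%N by clear -iN jN; lia.
exact: (h (Ordinal l)).
Qed.

Variables (C1 q D : R).
Hypothesis C1_ge1 : 1 <= C1.
Hypothesis g_le : forall t x, l1norm (cayley t *m g x) <= C1.
Hypothesis q_ge1 : 1 <= q.
Hypothesis C0_le : C0 <= q ^+ n.

Definition nunsafe k x := (\sum_(0 <= j < k) unsafe (iter j f x))%N.

Hypothesis D_ge : 2 * C1 ^+ N <= D.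

Let D_ge1 : 1 <= D.
Proof. by apply: le_trans D_ge; have := exprn_ege1 N C1_ge1; lra. Qed.

Lemma mprod_le_D x k : (k <= N)%N -> l1norm (mprod (orbmx f controlled x) k) <= D.
Proof.
move=> kN; have C10 : 0 <= C1 := le_trans ler01 C1_ge1.
apply: le_trans (l1norm_mprod C10 _) _ => [i _|]; first exact: g_le.
by apply: le_trans D_ge; rewrite ler_wpM2l // ler_weXn2l.
Qed.

Lemma mprod_orbmxD (h : K -> 'M[R]_2) x a b : mprod (orbmx f h x) (a + b) =
  mprod (orbmx f h (iter a f x)) b *m mprod (orbmx f h x) a.
Proof.
rewrite mprodD; congr (_ *m _); apply: eq_mprod => i _.
by rewrite /orbmx iterD.
Qed.

Lemma nunsafeD k l x : nunsafe (k + l) x = (nunsafe k x + nunsafe l (iter k f x))%N.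
Proof.
rewrite /nunsafe (big_cat_nat (n := k)) ?leq_addr //=; congr (_ + _)%N.
rewrite -{1}[k]add0n big_addn addKn; apply: eq_bigr => j _.
by rewrite iterD.
Qed.

(** Induction block by block: a safe block of length r contributes at most q^r
because its product is at most [C0] and r is at least [n]; any other block
contributes at most [D], which is charged to its unsafe initial point. *)
Lemma growth_base k x : above ord0 x ->
  l1norm (mprod (orbmx f controlled x) k) <= D * q ^+ k * D ^+ nunsafe k x.
Proof.
have D0 : 0 <= D := le_trans ler01 D_ge1.
have q0 : 0 <= q := le_trans ler01 q_ge1.
elim/ltn_ind: k x => k IH x hx; have [nr rN hr _] := return_timeP hx.
have [kr|rk] := ltnP k (return_time x).
  apply: le_trans (mprod_le_D _ _) _; first by apply: leq_trans rN; exact: ltnW.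
  rewrite -mulrA -[leLHS]mulr1 ler_wpM2l // mulr_ege1 // exprn_ege1 //.
set r := return_time x in nr rN hr rk.
rewrite -(subnKC rk) mprod_orbmxD nunsafeD.
apply: le_trans (l1normM _ _) _.
have r0 : (0 < r)%N by [].
have h1 : l1norm (mprod (orbmx f controlled x) r) <= q ^+ r * D ^+ nunsafe r x.
  have [bx|bx] := boolP (unsafe x).
    apply: le_trans (mprod_le_D _ rN) _.
    have -> : nunsafe r x = (nunsafe r x).-1.+1.
      by rewrite prednK // /nunsafe big_ltn // addn_gt0 /= bx.
    by rewrite exprS mulrCA ler_peMr // mulr_ege1 // exprn_ege1.
  apply: le_trans (good_block hx bx) _; apply: le_trans C0_le _.
  apply: le_trans (_ : q ^+ r <= _); first by rewrite ler_weXn2l.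
  by rewrite ler_peMr ?exprn_ge0 // exprn_ege1.
have h2 := IH (k - r)%N _ (iter r f x) hr.
apply: le_trans (ler_pM _ _ (h2 _) h1) _; rewrite ?l1norm_ge0 //.
  by rewrite ltn_subrL r0 (leq_trans r0 rk).
by rewrite !exprD le_eqVlt; apply/orP; left; apply/eqP; ring.
Qed.

Lemma growth k x :
  l1norm (mprod (orbmx f controlled x) k) <= D ^+ 2 * q ^+ k * D ^+ nunsafe k x.
Proof.
have D0 : 0 <= D := le_trans ler01 D_ge1.
have q0 : 0 <= q := le_trans ler01 q_ge1.
have [a aN ha] := visit x.
have [ka|ak] := leqP k a.
  apply: le_trans (mprod_le_D _ _) _; first exact: leq_trans ka (ltnW aN).
  have h : 1 <= D * q ^+ k * D ^+ nunsafe k x.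
    by apply: mulr_ege1; [apply: mulr_ege1 => //|]; exact: exprn_ege1.
  by have := ler_peMr D0 h; rewrite !mulrA -expr2.
rewrite -(subnKC (ltnW ak)) mprod_orbmxD nunsafeD.
apply: le_trans (l1normM _ _) _.
apply: le_trans (ler_pM _ _ (growth_base (k - a) ha) (mprod_le_D x (ltnW aN))) _; rewrite ?l1norm_ge0 //.
have -> : D ^+ 2 * q ^+ (a + (k - a)) * D ^+ (nunsafe a x + nunsafe (k - a) (iter a f x)) =
  D * q ^+ (k - a) * D ^+ nunsafe (k - a) (iter a f x) * D * (q ^+ a * D ^+ nunsafe a x).
  by rewrite !exprD; ring.
rewrite ler_peMr ?mulr_ge0 ?exprn_ge0 //.
by rewrite mulr_ege1 // exprn_ege1.
Qed.

(** A time close to a threshold makes at most 3 N + 1 initial points unsafe. *)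
Lemma nunsafe_le k x m : (forall y, (\sum_(l < k + 3 * N) near_threshold (iter l f y) <= m)%N) ->
  (nunsafe k x <= (3 * N).+1 * m)%N.
Proof.
move=> h; rewrite /nunsafe big_mkord.
apply: (@leq_trans (\sum_(j < k) \sum_(a < (3 * N).+1) near_threshold (iter (j + a) f (back x)))).
  apply: leq_sum => j _; case: (boolP (unsafe _)) => // /existsP[a ha].
  have e : iter a f (back (iter j f x)) = iter (j + a) f (back x).
    rewrite addnC iterD /back; congr (iter a f _).
    have -> : iter j f x = iter j f (iter N f (iter N (homeo_inv f) x)) by rewrite homeo_iter_invK.
    by rewrite -iterD addnC iterD homeo_iterK.
  by rewrite (bigD1 a) //= -e ha.
rewrite exchange_big /= -[X in (_ <= X * _)%N]card_ord -sum_nat_const.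
apply: leq_sum => a _; apply: leq_trans (h (back x)).
rewrite -!(big_mkord xpredT (fun l => near_threshold (iter l f (back x)) : nat)).
have aN : (a + k <= k + 3 * N)%N by rewrite addnC leq_add2l -ltnS ltn_ord.
rewrite (big_cat_nat (n := (a + k)%N)) //= (big_cat_nat (n := a)) ?leq_addr //=.
apply: leq_trans (leq_trans (leq_addl _ _) (leq_addr _ _)).
have -> : (\sum_(a <= i < a + k) near_threshold (iter i f (back x)) =
    \sum_(0 <= j < k) near_threshold (iter (j + a) f (back x)))%N.
  by rewrite -{1}[nat_of_ord a]add0n big_addn addKn.
by rewrite big_mkord.
Qed.

End blocks.

(** * Small perturbations with small growth *)

Section perturbation.
Variables (R : realType) (K : topologicalType) (f : homeo K K) (d : nat)
  (c : 'I_d -> K -> R).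
Hypothesis cK : compact [set: K].
Hypothesis mf : minimal f.
Hypothesis cts_c : forall j, continuous (c j).
Hypothesis basis : forall y U, nbhs y U -> exists2 r : R, 0 < r &
  forall x, (forall j, `|c j x - c j y| < r) -> U x.
Hypothesis sep : forall x y, (forall j, c j x = c j y) -> x = y.
Hypothesis aper : forall x i, (0 < i)%N -> iter i f x <> x.
Variable g : K -> 'M[R]_2.
Hypotheses (cg : entrywise_continuous g) (dg : forall x, \det (g x) = 1).

Lemma perturbed_orbit_continuous (t : nat -> R) r :
  continuous (fun x => l1norm (mprod (perturb t (orbmx f g x)) r)).
Proof.
apply: l1norm_continuous; apply: entrywise_continuous_mprod => i.
by apply: entrywise_continuousM; [exact: entrywise_continuous_cst | exact: entrywise_continuous_orbmx].
Qed.

(** The order of the choices matters: the bound [C0] of the programs gives the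
minimal block length [n]; the marker then gives the maximal length [N], for
which finitely many programs are selected; these give the cost [D] of an
unsafe block, and then the time [m] after which the total cost of the unsafe
blocks is negligible; general position is finally required on orbit segments
of length [M], slightly longer than [m]. *)
Lemma slow_perturbation (eta q : R) (y0 : K) : slow_segments f g -> 0 < eta -> eta < 1 -> 1 < q ->
  exists t : K -> R, [/\ continuous t, forall x, `|t x| <= eta &
   exists2 m, (0 < m)%N & forall x,
     l1norm (mprod (orbmx f (fun x => cayley (t x) *m g x) x) m) < (q ^+ 2) ^+ m].
Proof.
move=> hslow eta0 eta1 q1.
have q0 : 0 < q := lt_trans ltr01 q1.
have [C C1 hC] := l1norm_bound cK cg.
have [C0 hC0] := orbit_program cK mf cg dg hslow eta0 eta1.
have [n0 hn0] := exprn_unbounded (C0 + 1) q1.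
pose n := n0.+1.
have hn : C0 + 1 <= q ^+ n by apply/ltW/hn0.
have [chi0 cchi0 [ret0 [N visit0]]] := exists_marker cK mf cts_c basis sep aper n (ex_intro _ y0 I).
have /choice[prog0 hprog0] : forall y, exists P : nat -> nat -> R, forall r,
    (forall j, `|P r j| <= eta) /\ l1norm (mprod (perturb (P r) (orbmx f g y)) r) <= C0.
  move=> y; have /choice[P hP] : forall r, exists t : nat -> R,
     (forall j, `|t j| <= eta) /\ l1norm (mprod (perturb t (orbmx f g y)) r) <= C0.
    by move=> r; have [t h1 h2] := hC0 y r; exists t.
  by exists P.
have /choice[bump hbump] : forall y : K, exists chi : K -> R, [/\ continuous chi, chi y = 1 &
    forall x, 0 < chi x -> forall r : 'I_N.+1,
      l1norm (mprod (perturb (prog0 y r) (orbmx f g x)) r) < C0 + 1].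
  move=> y.
  have nU : nbhs y [set x | forall r : 'I_N.+1,
      l1norm (mprod (perturb (prog0 y r) (orbmx f g x)) r) < C0 + 1].
    apply: filter_forall => r.
    apply: (@nbhs_lt _ _ _ (C0 + 1) y (@perturbed_orbit_continuous (prog0 y r) r)).
    by apply: le_lt_trans (hprog0 y r).2 _; rewrite ltrDl.
  by have [chi h1 [h2 h3]] := exists_bump cts_c basis nU; exists chi.
have [|s hs] := @compact_fincover _ cK (fun y => [set x | 3/4 < bump y x]).
  by move=> y; have [h1 h2 _] := hbump y; apply: nbhs_gt => //; rewrite h2; lra.
pose p := size s.
pose chi (i : 'I_p.+1) := if unlift ord0 i is Some k then bump (nth y0 s k) else chi0.
have cchi i : continuous (chi i).
  by rewrite /chi; case: (unlift ord0 i) => [k|//]; have [] := hbump (nth y0 s k).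
pose D := 2 * (4 * C) ^+ N.
have C41 : 1 <= 4 * C by lra.
have D1 : 1 <= D by rewrite /D; have := exprn_ege1 N C41; lra.
have [m0 hm0] := exprn_unbounded (D ^+ 2 * D ^+ ((3 * N).+1 * d)) q1.
pose m := m0.+1; pose M := (m + 3 * N)%N.
have hm : D ^+ 2 * D ^+ ((3 * N).+1 * d) < q ^+ m by apply: hm0; exact: leqnSn.
have [bs htow hbs] := tower_cover cK cts_c basis sep aper M.
have e0 : 0 < 4^-1 :> R by rewrite invr_gt0.
have [chi' [cchi' near' [delta delta0 hcross]]] :=
  general_position cK cts_c basis e0 cchi htow.
have near1 i x : chi i x - 4^-1 <= chi' i x <= chi i x + 4^-1.
  by rewrite -ler_distl.
have chi_ord0 : chi ord0 = chi0 by rewrite /chi unlift_none.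
have chi_lift k : chi (lift ord0 k) = bump (nth y0 s k) by rewrite /chi liftK.
pose prog (k : 'I_p) := prog0 (nth y0 s k).
have ret_ge x i : (0 < i < n)%N -> above chi' ord0 x -> ~~ above chi' ord0 (iter i f x).
  move=> hi; rewrite /above -leNgt => hx.
  have /andP[_ h1] := near1 ord0 x; have /andP[_ h2] := near1 ord0 (iter i f x).
  rewrite chi_ord0 in h1 h2.
  have h3 := ret0 x i hi; have : chi0 (iter i f x) <= 0 by apply: h3; lra.
  lra.
have visit x : exists2 k, (k < N)%N & above chi' ord0 (iter k f x).
  have [k kN hk] := visit0 x; exists k => //; rewrite /above.
  by have /andP[h1 _] := near1 ord0 (iter k f x); rewrite chi_ord0 in h1; lra.
have select x : exists k : 'I_p, above chi' (lift ord0 k) x.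
  have [y ys /= hy] := hs x.
  have ip : (index y s < p)%N by rewrite index_mem.
  exists (Ordinal ip); rewrite /above.
  have /andP[h1 _] := near1 (lift ord0 (Ordinal ip)) x.
  by rewrite chi_lift /= nth_index // in h1; lra.
have prog_le k r j : `|prog k r j| <= eta := (hprog0 _ r).1 j.
have prog_ok (k : 'I_p) x r : (r <= N)%N -> above chi' (lift ord0 k) x ->
    l1norm (mprod (perturb (prog k r) (orbmx f g x)) r) <= C0 + 1.
  rewrite -ltnS /above => rN hx.
  have /andP[_ h1] := near1 (lift ord0 k) x; rewrite chi_lift in h1.
  have [_ _ hb] := hbump (nth y0 s k).
  by apply: ltW; apply: (hb x _ (Ordinal rN)); lra.
have g_le t x : l1norm (cayley t *m g x) <= 4 * C.
  apply: le_trans (l1normM _ _) _; apply: ler_pM; rewrite ?l1norm_ge0 ?hC //.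
  exact: l1norm_cayley.
exists (control f N chi' prog delta); split.
- exact: (control_continuous delta0 cchi' (ltW eta0) prog_le).
- exact: (control_le f N chi' delta (ltW eta0) prog_le).
exists m => // x.
have hg := growth delta0 ret_ge visit select prog_ok C41 g_le (ltW q1) hn (lexx D) m x.
apply: le_lt_trans hg _.
have hnb : (nunsafe f N chi' delta m x <= (3 * N).+1 * d)%N.
  apply: nunsafe_le => y; have [beta hb b1] := hbs y.
  apply: leq_trans (hcross beta y hb b1); apply: leq_sum => l _.
  case: (boolP (near_threshold _ _ _)) => // /existsP[k hk].
  by rewrite (bigD1 k) //= hk.
have -> : (q ^+ 2) ^+ m = q ^+ m * q ^+ m by rewrite exprAC expr2.
rewrite mulrAC ltr_pM2r ?exprn_gt0 //; apply: le_lt_trans hm.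
by apply: ler_wpM2l; [exact: exprn_ge0 (le_trans ler01 D1) | exact: ler_weXn2l].
Qed.

End perturbation.

(** * Norms, closeness of rotations, embedding in Euclidean space *)

Section norms.
Variable R : realType.
Implicit Types (M : 'M[R]_2) (v : 'cV[R]_2).

Lemma euclidean_norm2 v : euclidean_norm v = Num.sqrt (sqn v).
Proof.
rewrite /euclidean_norm !big_ord_recl big_ord0 addr0 /sqn.
by congr (Num.sqrt (v _ _ ^+ 2 + v _ _ ^+ 2)); apply: val_inj.
Qed.

Lemma euclidean_norm_mulmx M v : euclidean_norm v <= 1 ->
  euclidean_norm (M *m v) <= l1norm M.
Proof.
rewrite !euclidean_norm2 => v1.
have sv : sqn v <= 1.
  by rewrite -(sqr_sqrtr (sqn_ge0 v)) expr_le1 // sqrtr_ge0.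
rewrite -[leRHS]ger0_norm ?l1norm_ge0 // -sqrtr_sqr; apply: ler_wsqrtr.
apply: le_trans (sqn_mulmx _ _) _; apply: le_trans _ (sqnmx_l1norm M).
by rewrite -[leRHS]mulr1 ler_wpM2l // sqnmx_ge0.
Qed.

Lemma euclidean_norm0 : euclidean_norm (0 : 'cV[R]_2) <= 1.
Proof. by rewrite euclidean_norm2 /sqn !mxE expr0n addr0 sqrtr0. Qed.

Lemma opnorm_le M : opnorm M <= l1norm M.
Proof.
apply: ge_sup; first by exists (euclidean_norm (M *m 0)); exists 0 => //; exact: euclidean_norm0.
by move=> _ [v v1 <-]; exact: euclidean_norm_mulmx.
Qed.

Lemma l1norm_le_opnorm M : l1norm M <= 4 * opnorm M.
Proof.
have ub v : euclidean_norm v <= 1 -> euclidean_norm (M *m v) <= opnorm M.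
  move=> v1; apply: ub_le_sup; last by exists v.
  by exists (l1norm M) => _ [w w1 <-]; exact: euclidean_norm_mulmx.
have ent v i : `|v i 0| <= euclidean_norm v.
  rewrite euclidean_norm2 -sqrtr_sqr; apply: ler_wsqrtr; rewrite /sqn.
  by case: (ord2P i) => ->; rewrite ?lerDl ?lerDr sqr_ge0.
pose e (j : 'I_2) : 'cV[R]_2 := \col_i (i == j)%:R.
have e1 j : euclidean_norm (e j) <= 1.
  rewrite euclidean_norm2 /sqn !mxE.
  by case: (ord2P j) => ->; rewrite /= ?expr0n ?expr1n ?addr0 ?add0r sqrtr1.
have Me i j : `|M i j| <= opnorm M.
  apply: le_trans (ub _ (e1 j)); apply: le_trans (ent _ i).
  rewrite mulmx2E !mxE; case: (ord2P j) => ->; rewrite /= ?mulr0 ?mulr1 ?addr0 ?add0r //.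
rewrite l1normE2; have := Me 0 0; have := Me 0 1; have := Me 1 0; have := Me 1 1; lra.
Qed.

End norms.

Section rotcts.
Variables (R : realType) (K : topologicalType).

Lemma entrywise_continuous_cayley (t : K -> R) : continuous t -> entrywise_continuous (fun x => cayley (t x)).
Proof.
move=> ct.
have c2 : continuous (fun x => 1 + t x ^+ 2).
  by apply: ctsD; [exact: cts_cst | exact: ctsM].
have ci : continuous (fun x => (1 + t x ^+ 2)^-1).
  move=> x; apply: (@continuousV _ _ (fun x => 1 + t x ^+ 2)); last exact: c2.
  by rewrite gt_eqF // onesqr_gt0.
have cc : continuous (fun x => (1 - t x ^+ 2) / (1 + t x ^+ 2)).
  by apply: ctsM => //; apply: ctsB; [exact: cts_cst | exact: ctsM].
have cs : continuous (fun x => 2 * t x / (1 + t x ^+ 2)).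
  by apply: ctsM => //; apply: ctsM => //; exact: cts_cst.
have csN : continuous (fun x => - (2 * t x / (1 + t x ^+ 2))).
  have := ctsB (@cts_cst R K 0) cs.
  by have -> : (fun x => 0 - 2 * t x / (1 + t x ^+ 2)) = (fun x => - (2 * t x / (1 + t x ^+ 2)))
    by apply/funext => x; rewrite sub0r.
move=> i j; case: (ord2P i) => ->; case: (ord2P j) => ->.
- by have -> : (fun x => cayley (t x) 0 0) = (fun x => (1 - t x ^+ 2) / (1 + t x ^+ 2))
    by apply/funext => x; rewrite mx2E.
- by have -> : (fun x => cayley (t x) 0 1) = (fun x => - (2 * t x / (1 + t x ^+ 2)))
    by apply/funext => x; rewrite mx2E.
- by have -> : (fun x => cayley (t x) 1 0) = (fun x => 2 * t x / (1 + t x ^+ 2))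
    by apply/funext => x; rewrite mx2E.
- by have -> : (fun x => cayley (t x) 1 1) = (fun x => (1 - t x ^+ 2) / (1 + t x ^+ 2))
    by apply/funext => x; rewrite mx2E.
Qed.

Lemma cayley_close (t : R) (M : 'M[R]_2) i j : `|t| <= 1 ->
  `|M i j - (cayley t *m M) i j| <= 2 * `|t| * l1norm M.
Proof.
move=> t1; have u0 := onesqr_gt0 t.
have a0 := normr_ge0 t.
have t2 : t ^+ 2 = `|t| ^+ 2 by rewrite real_normK // num_real.
have h1 : `|(1 - t ^+ 2) / (1 + t ^+ 2) - 1| <= 2 * `|t|.
  have -> : (1 - t ^+ 2) / (1 + t ^+ 2) - 1 = - (2 * t ^+ 2 / (1 + t ^+ 2)).
    by field; rewrite gt_eqF.
  rewrite normrN normf_div (gtr0_norm u0) ler_pdivrMr // normrM normrX ger0_norm // t2.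
  by move: `|t| a0 t1 => a a0 a1; nra.
have h2 : `|2 * t / (1 + t ^+ 2)| <= 2 * `|t|.
  rewrite normf_div (gtr0_norm u0) ler_pdivrMr // normrM ger0_norm // t2.
  by move: `|t| a0 => a a0; have := exprn_ge0 3 a0; have -> : a ^+ 3 = a * a ^+ 2 by []; nra.
have hj (a b : R) k : `|a| <= 2 * `|t| -> `|b| <= 2 * `|t| ->
    `|a * M 0 k + b * M 1 k| <= 2 * `|t| * l1norm M.
  move=> ha hb; apply: le_trans (ler_normD _ _) _; rewrite !normrM.
  apply: (@le_trans _ _ (2 * `|t| * (`|M 0 k| + `|M 1 k|))).
    by rewrite mulrDr lerD // ler_wpM2r.
  rewrite ler_wpM2l ?mulr_ge0 // l1normE2.
  have := normr_ge0 (M 0 0); have := normr_ge0 (M 0 1).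
  have := normr_ge0 (M 1 0); have := normr_ge0 (M 1 1).
  by case: (ord2P k) => ->; lra.
rewrite mulmx2E distrC; case: (ord2P i) => ->; rewrite !mx2E.
  have -> : (1 - t ^+ 2) / (1 + t ^+ 2) * M 0 j + - (2 * t / (1 + t ^+ 2)) * M 1 j - M 0 j =
    ((1 - t ^+ 2) / (1 + t ^+ 2) - 1) * M 0 j + - (2 * t / (1 + t ^+ 2)) * M 1 j by ring.
  by apply: hj => //; rewrite normrN.
have -> : 2 * t / (1 + t ^+ 2) * M 0 j + (1 - t ^+ 2) / (1 + t ^+ 2) * M 1 j - M 1 j =
    2 * t / (1 + t ^+ 2) * M 0 j + ((1 - t ^+ 2) / (1 + t ^+ 2) - 1) * M 1 j by ring.
exact: hj.
Qed.

End rotcts.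

Section coordinates.
Variables (R : realType) (K : topologicalType).

(** The coordinates of an embedding in Euclidean space contain all that is
needed of the hypothesis of finite dimension. *)
Lemma finite_dimension_coords : finite_dimension R K ->
  exists d (c : 'I_d -> K -> R), [/\ forall j, continuous (c j),
    forall y U, nbhs y U -> exists2 r : R, 0 < r &
      forall x, (forall j, `|c j x - c j y| < r) -> U x &
    forall x y, (forall j, c j x = c j y) -> x = y].
Proof.
move=> [d [S [h]]]; exists d, (fun j x => val (h x) 0 j).
have cval : continuous (fun x => val (h x)).
  move=> x; apply: (@continuous_comp _ _ _ h val); first exact: homeo_continuous.
  exact: initial_continuous.
split.
- move=> j x; apply: (@continuous_comp _ _ _ (fun x => val (h x)) (fun v : 'rV[R]_d => v 0 j)).
    exact: cval.
  exact: coord_continuous.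
- move=> y U nU.
  have : nbhs (h y) [set s | U (homeo_inv h s)].
    by apply: (@homeo_inv_continuous _ _ h (h y)); rewrite homeo_funK.
  move=> [_ [[W oW <-] Wy WU]].
  have : nbhs (val (h y)) W by apply: open_nbhs_nbhs.
  move=> /nbhs_ballP[r /= r0 hr]; exists r => // x hx.
  rewrite -(homeo_funK h x); apply: WU; apply: hr; rewrite ball_mxE // => i j.
  by rewrite distrC ord1; exact: hx.
- move=> x y e; apply: (can_inj (homeo_funK h)); apply: val_inj.
  by apply/matrixP => i j; rewrite ord1; exact: e.
Qed.

End coordinates.

(** * Residual set *)

Section final.
Variables (R : realType) (K : topologicalType) (f : homeo K K).
Hypothesis cK : compact [set: K].
Hypothesis mf : minimal f.
Implicit Types (A B : CSL2 R K).

Definition matrix_of A x := val (A x).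

Lemma det_matrix_of A x : \det (matrix_of A x) = 1.
Proof. by have := valP (A x); rewrite inE. Qed.

Lemma matrix_of_continuous A : entrywise_continuous (matrix_of A).
Proof. by apply: continuous_entrywise; exact: val_CSL2_continuous. Qed.

Lemma cocycle_iterE A n x : cocycle_iter f A n x = mprod (orbmx f (matrix_of A) x) n.
Proof. by elim: n => //= n ->. Qed.

Lemma not_uniformly_hyperbolic_slow_segments A : ~ uniformly_hyperbolic f A -> slow_segments f (matrix_of A).
Proof.
move=> nuh q N q1; apply: contrapT => h; apply: nuh.
exists (ln q); first by rewrite ln_gt0.
exists N.+1 => // x n nN; rewrite leNgt; apply/negP => hlt; apply: h.
exists x, n; split; first exact: ltnW.
rewrite -cocycle_iterE; apply: le_lt_trans (l1norm_le_opnorm _) _.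
rewrite ltr_pM2l //; apply: (lt_le_trans hlt).
by rewrite expRM_natr lnK // posrE (lt_trans ltr01).
Qed.

(** By submultiplicativity a single iterate below the rate bounds the growth of
all iterates at that rate. *)
Definition rate_below (q : R) : set (CSL2 R K) :=
  [set A | exists2 m, (0 < m)%N & forall x,
     l1norm (mprod (orbmx f (matrix_of A) x) m) < q ^+ m].

(** Iterates of a given order depend continuously on the cocycle, uniformly in
the initial point. *)
Lemma mprod_perturb (g : K -> 'M[R]_2) (C : R) m (gam : R) :
  1 <= C -> (forall x, l1norm (g x) <= C) -> 0 < gam ->
  exists2 rho : R, 0 < rho & forall g' : K -> 'M[R]_2,
    (forall x, l1norm (g' x - g x) < rho) ->
    forall x, l1norm (mprod (orbmx f g' x) m - mprod (orbmx f g x) m) < gam.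
Proof.
move=> C1 hC; elim: m gam => [|m IH] gam gam0.
  by exists 1 => // g' _ x; rewrite /= subrr /l1norm big1 // => i _; rewrite big1 // => j _; rewrite mxE normr0.
have C0 : 0 < C := lt_le_trans ltr01 C1.
have D0 : 0 < 2 * C ^+ m by rewrite mulr_gt0 // exprn_gt0.
have [r1 r10 h1] := IH (gam / (2 * (C + 1))) (divr_gt0 gam0 (mulr_gt0 (ltr0n _ 2) (addr_gt0 C0 ltr01))).
(* The three terms make g' bounded by C + 1, the error on the shorter product small, and the error on the last factor small against the product. *)
exists (Num.min (Num.min 1 r1) (gam / (2 * (2 * C ^+ m)))).
  by rewrite !lt_min ltr01 r10 divr_gt0 // mulr_gt0.
move=> g' hg x.
have hg1 y : l1norm (g' y - g y) < 1 by have := hg y; rewrite !lt_min => /andP[/andP[]].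
have hg2 y : l1norm (g' y - g y) < r1 by have := hg y; rewrite !lt_min => /andP[/andP[]].
have hg3 y : l1norm (g' y - g y) < gam / (2 * (2 * C ^+ m)).
  by have := hg y; rewrite !lt_min => /andP[_].
have := h1 g' hg2 x; set P' := mprod (orbmx f g' x) m; set P := mprod (orbmx f g x) m => hP.
set y := iter m f x.
have -> : mprod (orbmx f g' x) m.+1 - mprod (orbmx f g x) m.+1 =
   g' y *m (P' - P) + (g' y - g y) *m P.
  by rewrite /= -/P -/P' /orbmx -/y mulmxBr mulmxBl addrA subrK.
apply: le_lt_trans (l1normD _ _) _.
have e1 : l1norm (g' y *m (P' - P)) <= (C + 1) * l1norm (P' - P).
  apply: le_trans (l1normM _ _) _; apply: ler_wpM2r; first exact: l1norm_ge0.
  have -> : g' y = g y + (g' y - g y) by rewrite addrC subrK.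
  by apply: le_trans (l1normD _ _) _; apply: lerD; [exact: hC | exact/ltW/hg1].
have e2 : l1norm ((g' y - g y) *m P) <= l1norm (g' y - g y) * (2 * C ^+ m).
  apply: le_trans (l1normM _ _) _; apply: ler_wpM2l; first exact: l1norm_ge0.
  by apply: (l1norm_mprod (ltW C0)) => i _; exact: hC.
have e3 : (C + 1) * l1norm (P' - P) < gam / 2.
  have := hP; rewrite ltr_pdivlMr ?mulr_gt0 ?addr_gt0 //; lra.
have e4 : l1norm (g' y - g y) * (2 * C ^+ m) < gam / 2.
  by have := hg3 y; rewrite ltr_pdivlMr ?mulr_gt0 //; lra.
lra.
Qed.

Lemma l1norm_lt_entries (M : 'M[R]_2) (r : R) : (forall i j, `|M i j| < r) -> l1norm M < 4 * r.
Proof.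
by move=> h; rewrite l1normE2; have := h 0 0; have := h 0 1; have := h 1 0; have := h 1 1; lra.
Qed.

Lemma open_rate_below q : open (rate_below q).
Proof.
rewrite openE => A [m m0 hm]; apply/nbhs_CSL2P.
have [C C1 hC] := l1norm_bound cK (@matrix_of_continuous A).
have cm : continuous (fun x => l1norm (mprod (orbmx f (matrix_of A) x) m)).
  by apply: l1norm_continuous; apply: entrywise_continuous_mprod => i; exact: (entrywise_continuous_orbmx (@matrix_of_continuous A)).
have [d d0 hd] := compact_lt_margin cK cm hm.
have [rho rho0 hrho] := mprod_perturb m C1 hC d0.
exists (rho / 4); first by rewrite divr_gt0.
move=> B hB; exists m => // x.
have h : l1norm (mprod (orbmx f (matrix_of B) x) m - mprod (orbmx f (matrix_of A) x) m) < d.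
  apply: hrho => y; have -> : rho = 4 * (rho / 4) by rewrite mulrC divfK.
  by apply: l1norm_lt_entries => i j; rewrite !mxE distrC; exact: hB.
have := l1normD (mprod (orbmx f (matrix_of B) x) m - mprod (orbmx f (matrix_of A) x) m)
  (mprod (orbmx f (matrix_of A) x) m).
by rewrite subrK; have := hd x; lra.
Qed.

Lemma rate_below_bound A q : 1 < q -> rate_below q A ->
  exists D : R, forall x n, l1norm (mprod (orbmx f (matrix_of A) x) n) <= D * q ^+ n.
Proof.
move=> q1 [m m0 hm].
have [C C1 hC] := l1norm_bound cK (@matrix_of_continuous A).
have C0 : 0 <= C := le_trans ler01 C1.
exists (2 * C ^+ m) => x n; elim/ltn_ind: n x => n IH x.
have [nm|mn] := ltnP n m.
  apply: le_trans (l1norm_mprod C0 (fun i _ => hC _)) _.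
  rewrite -mulrA ler_wpM2l // -[leLHS]mulr1 ler_pM ?exprn_ge0 ?exprn_ege1 ?(ltW q1) //.
  by rewrite ler_weXn2l // ltnW.
rewrite -(subnKC mn) mprod_orbmxD exprD.
apply: le_trans (l1normM _ _) _.
have h1 := IH (n - m)%N; have h2 : (n - m < n)%N by rewrite ltn_subrL m0 (leq_trans m0 mn).
apply: le_trans (ler_pM _ _ (h1 h2 _) (ltW (hm x))) _; rewrite ?l1norm_ge0 //.
by rewrite le_eqVlt; apply/orP; left; apply/eqP; ring.
Qed.

Lemma subexponential_of_rates A :
  (forall k : nat, rate_below (1 + k.+1%:R^-1) A) -> uniform_subexponential_growth f A.
Proof.
move=> h eps eps0.
have e2 : 0 < eps / 2 by rewrite divr_gt0.
(* Half of the exponent pays for the rate q, the other half for the constant D. *)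
pose k := Num.bound (eps / 2)^-1.
pose q := 1 + k.+1%:R^-1 : R.
have q1 : 1 < q by rewrite ltrDl invr_gt0.
have qe : q <= expR (eps / 2).
  apply: (@le_trans _ _ (1 + eps / 2)); last exact: expR_ge1Dx.
  rewrite lerD2l -[leRHS]invrK lef_pV2 ?posrE ?invr_gt0 //.
  apply/ltW; apply: lt_le_trans (archi_boundP _) _; first by rewrite invr_ge0 ltW.
  by rewrite ler_nat.
have [D hD] := rate_below_bound q1 (h k).
have e1 : 1 < expR (eps / 2) by rewrite expR_gt1.
have [N hN] := exprn_unbounded D e1.
exists N.+1 => // x n nN; apply: le_trans (opnorm_le _) _.
rewrite cocycle_iterE; apply: (le_trans (hD x n)).
have -> : eps * n%:R = eps / 2 * n%:R + eps / 2 * n%:R by rewrite -mulrDl -splitr.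
rewrite expRD !expRM_natr; apply: ler_pM.
- rewrite -(@pmulr_lge0 _ (q ^+ n)) ?exprn_gt0 ?(lt_trans ltr01 q1) //.
  exact: le_trans (l1norm_ge0 _) (hD x n).
- by rewrite exprn_ge0 // (le_trans ler01) // ltW.
- by apply/ltW/hN/ltnW.
- by rewrite lerXn2r // nnegrE ?expR_ge0 // (le_trans ler01) // ltW.
Qed.

Section coords.
Variables (d : nat) (c : 'I_d -> K -> R).
Hypothesis cts_c : forall j, continuous (c j).
Hypothesis basis : forall y U, nbhs y U -> exists2 r : R, 0 < r &
  forall x, (forall j, `|c j x - c j y| < r) -> U x.
Hypothesis sep : forall x y, (forall j, c j x = c j y) -> x = y.

(** A finite orbit is closed, so by density it is everything. *)
Lemma periodic_orbit_full x i : (0 < i)%N -> iter i f x = x ->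
  forall y, exists2 j, (j < i)%N & iter j f x = y.
Proof.
move=> i0 fx y; apply: contrapT => ny.
have per k : iter (i * k) f x = x.
  by elim: k => [|k IH]; rewrite ?muln0 // mulnS iterD IH.
have nU : \forall z \near y, forall j : 'I_i, z <> iter j f x.
  apply: filter_forall => j.
  have [k hk] : exists k, c k (iter j f x) <> c k y.
    apply: contrapT => /forallNP h; apply: ny; exists j => //.
    by apply: sep => k; apply: contrapT; exact: h.
  have r0 : 0 < `|c k y - c k (iter j f x)|.
    by rewrite normr_gt0 subr_eq0; apply/eqP => e; apply: hk.
  have ck : {for y, continuous (c k)} by exact: cts_c.
  move/cvgrPdist_lt: ck => /(_ _ r0); apply: filterS => z hz e.
  by move: hz; rewrite e ltxx.
have [n hn] := minimal_visit x mf (open_interior _) (ex_intro _ y nU).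
have {hn} hn := interior_subset hn.
have [k ek] : exists k, ziter f n x = iter k f x.
  case: n {hn} => k; first by exists k.
  exists (i * k.+1 - k.+1)%N; rewrite -(@iter_inv_iter _ f _ k.+1) ?per //.
  by rewrite leq_pmull.
have ki : (k %% i < i)%N by rewrite ltn_mod.
apply: (hn (Ordinal ki)); rewrite /= ek {1}(divn_eq k i) addnC iterD.
by rewrite mulnC per.
Qed.

(** All points being on the same periodic orbit, the products of length n at two
points are conjugate by products of bounded length, so one slow segment
makes all segments of the same length slow. *)
Lemma periodic_rate_below A (q : R) x i : (0 < i)%N -> iter i f x = x ->
  1 < q -> slow_segments f (matrix_of A) -> rate_below q A.
Proof.
move=> i0 fx q1 hslow.
have orb := periodic_orbit_full i0 fx.
have [C C1 hC] := l1norm_bound cK (@matrix_of_continuous A).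
have C0 : 0 <= C := le_trans ler01 C1.
set p := Num.sqrt q.
have q0 : 0 < q := lt_trans ltr01 q1.
have p2 : p ^+ 2 = q by rewrite sqr_sqrtr // ltW.
have p0 : 0 < p by rewrite sqrtr_gt0.
have p1 : 1 < p by rewrite -(@ltr_pXn2r _ 2) ?nnegrE ?(ltW p0) // p2 expr1n.
set D := 2 * C ^+ (2 * i).
have D0 : 0 <= D by rewrite mulr_ge0 // exprn_ge0.
have [N hN] := exprn_unbounded (D * (D * 4)) p1.
have [z [n [nN hz]]] := hslow p N.+1 p1.
exists n; first exact: leq_trans nN.
move=> y.
have [j ji ej] : exists2 j, (j <= 2 * i)%N & iter j f y = z.
  have [a ai ea] := orb y; have [b bi eb] := orb z.
  exists (i - a + b)%N; first by rewrite mul2n -addnn leq_add ?leq_subr // ltnW.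
  by rewrite -ea -iterD addnAC subnK ?(ltnW ai) // addnC iterD fx.
have hj w : l1norm (mprod (orbmx f (matrix_of A) w) j) <= D.
  apply: le_trans (l1norm_mprod C0 (fun i _ => hC _)) _.
  by rewrite ler_wpM2l // ler_weXn2l.
have dj w : \det (mprod (orbmx f (matrix_of A) w) j) = 1.
  by apply: det_mprod => k; exact: det_matrix_of.
have e1 := mprod_orbmxD f (matrix_of A) y j n.
have e2 := mprod_orbmxD f (matrix_of A) y n j.
rewrite ej in e1.
have [_ h1] := l1norm_factor (mprod (orbmx f (matrix_of A) y) n) (dj (iter n f y)) (hj _).
have [h2 _] := l1norm_factorr (mprod (orbmx f (matrix_of A) z) n) (dj y) (hj y).
rewrite -e2 addnC e1 in h1.
have qE : q ^+ n = p ^+ n * p ^+ n by rewrite -p2 exprAC expr2.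
apply: (le_lt_trans h1); apply: (le_lt_trans (ler_wpM2l D0 h2)).
have hn := hN n (ltnW nN).
rewrite qE; apply: (@le_lt_trans _ _ (D * (D * 4) * p ^+ n)).
  apply: le_trans (ler_wpM2l D0 (ler_wpM2l D0 (ltW hz))) _.
  by rewrite le_eqVlt; apply/orP; left; apply/eqP; ring.
by rewrite ltr_pM2r ?exprn_gt0.
Qed.

(** A nonempty open set either consists of uniformly hyperbolic cocycles, and
then meets the interior, or contains a cocycle with slow segments, to which
[slow_perturbation] or [periodic_rate_below] applies. *)
Lemma dense_rates (q : R) : 1 < q ->
  dense ([set A : CSL2 R K | uniformly_hyperbolic f A]^° `|` rate_below q).
Proof.
move=> q1 O [A OA] oO.
have [OU|] := pselect (O `<=` [set A : CSL2 R K | uniformly_hyperbolic f A]).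
  exists A; split => //; left.
  by rewrite /interior; apply: filterS OU _; exact: open_nbhs_nbhs.
move=> /nonsubset[{OA}A [OA nuh]].
have hslow := not_uniformly_hyperbolic_slow_segments nuh.
have [[x [i [i0 fx]]]|aper] := pselect (exists x i, (0 < i)%N /\ iter i f x = x).
  by exists A; split => //; right; apply: periodic_rate_below fx q1 hslow.
have {}aper x i : (0 < i)%N -> iter i f x <> x by move=> i0 e; apply: aper; exists x, i.
have [y0 _] := hslow 2 0%N (ltr1n _ 2).
have /nbhs_CSL2P[dl dl0 hdl] : nbhs A O by exact: open_nbhs_nbhs.
have [C C1 hC] := l1norm_bound cK (@matrix_of_continuous A).
have C0 : 0 < C := lt_le_trans ltr01 C1.
set eta := Num.min (1 / 2) (dl / (4 * C)).
have eta0 : 0 < eta by rewrite lt_min !divr_gt0 // mulr_gt0.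
have eta1 : eta <= 1 / 2 by rewrite ge_min lexx.
have etad : eta <= dl / (4 * C) by rewrite ge_min lexx orbT.
set p := Num.sqrt q.
have q0 : 0 < q := lt_trans ltr01 q1.
have p2 : p ^+ 2 = q by rewrite sqr_sqrtr // ltW.
have p0 : 0 < p by rewrite sqrtr_gt0.
have p1 : 1 < p by rewrite -(@ltr_pXn2r _ 2) ?nnegrE ?(ltW p0) // p2 expr1n.
have eta_lt1 : eta < 1 by lra.
have [t [ct ht [m m0 hm]]] := slow_perturbation cK mf cts_c basis sep aper
  (@matrix_of_continuous A) (det_matrix_of A) y0 hslow eta0 eta_lt1 p1.
have [|x|B hB] := @mk_CSL2 R K (fun x => cayley (t x) *m matrix_of A x).
- by apply: entrywise_continuousP; apply: entrywise_continuousM; [exact: entrywise_continuous_cayley | exact: matrix_of_continuous].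
- by rewrite det_mulmx det_cayley det_matrix_of mulr1.
have BE : matrix_of B = (fun x => cayley (t x) *m matrix_of A x) by apply/funext.
exists B; split.
  apply: hdl => x i j; rewrite hB.
  have t1 : `|t x| <= 1 by apply: le_trans (ht x) (ltW eta_lt1).
  apply: le_lt_trans (cayley_close (matrix_of A x) i j t1) _.
  have h1 : 2 * `|t x| * l1norm (matrix_of A x) <= 2 * (dl / (4 * C)) * C.
    apply: ler_pM; rewrite ?mulr_ge0 ?l1norm_ge0 // ler_wpM2l //.
    exact: le_trans (ht x) etad.
  apply: le_lt_trans h1 _.
  have -> : 2 * (dl / (4 * C)) * C = dl / 2 by field; rewrite gt_eqF.
  by rewrite ltr_pdivrMr // ltr_pMr // ltr1n.
by right; exists m => // x; rewrite BE -p2; exact: hm.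
Qed.

End coords.
End final.

Theorem theorem1 (R : realType) (K : topologicalType) (f : homeo K K) :
  compact [set: K] -> finite_dimension R K -> minimal f ->
  residual [set A : CSL2 R K |
    uniformly_hyperbolic f A \/ uniform_subexponential_growth f A].
Proof.
move=> cK /finite_dimension_coords[d [c [cts_c basis sep]]] mf.
pose F (k : nat) : set (CSL2 R K) :=
  [set A : CSL2 R K | uniformly_hyperbolic f A]^° `|` rate_below f (1 + k.+1%:R^-1).
exists (\bigcap_k F k).
  exists F => // k; split.
    by apply: openU; [exact: open_interior | exact: open_rate_below].
  by apply: (dense_rates cK mf cts_c basis sep); rewrite ltrDl invr_gt0.
move=> A hA /=.
have [uh|nuh] := pselect (uniformly_hyperbolic f A); first by left.
right; apply: (subexponential_of_rates cK) => k.
by have [/interior_subset|] := hA k I.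
Qed.
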